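(* Over {\rm GBC}, the principle {\rm ETR} of elementary transfinite recursion is equivalent to the assertion that for every class $Z$ and every class well-ordering $\langle I,\lhd\rangle$ there is an iterated truth predicate $T$ along $\langle I,\lhd\rangle$ over the parameter $Z$.
   Context: Work in G\''odel–Bernays set theory with global choice ({\rm GBC}). {\rm ETR} asserts: for every well-founded binary class relation $\lhd$ on a class $I$, every formula $\varphi(x,b,F,Z)$ with only set quantifiers and every class parameter $Z$, there is a class $F\subseteq I\times V$ such that for every $b\in I$, $F_b=\{x\mid (b,x)\in F\}=\{x\mid\varphi(x,b,F\restriction b,Z)\}$, where $F\restriction b=F\cap(\{c\in I\mid c\lhd b\}\times V)$. For a class well-order $\langle I,\lhd\rangle$ and class $Z$, an iterated truth predicate along $\langle I,\lhd\rangle$ over $Z$ is a class $T$ such that for each $i\in I$ the slice $T_i=\{x\mid\langle i,x\rangle\in T\}$ is a satisfaction class (a class of formula–assignment pairs obeying the Tarskian recursive truth conditions for atomic formulas, negation, conjunction and existential quantification) for the structure $\langle V,\in,Z,T\restriction i\rangle$, in the language of set theory augmented with predicates for $Z$ and $T\restriction i=T\cap(\{j\in I\mid j\lhd i\}\times V)$. *)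

(* Defs.v *)
From mathcomp Require Import all_boot.

Set Implicit Arguments.
Unset Strict Implicit.
Unset Printing Implicit Defensive.

(** * Two-sorted structures and formulas with only set quantifiers

    [C x] means that the set [x] belongs to the class [C].  Predicates
    [M -> Prop] are used for collections that need not be named by an element
    of [cls M], such as the restriction of a class. *)

Record structure := Structure {
  sets :> Type;
  cls : Type;
  mem : sets -> sets -> Prop;
  cmem : cls -> sets -> Prop
}.
Arguments mem {s} x y.
Coercion cmem : cls >-> Funclass.

Declare Scope gb_scope.
Open Scope gb_scope.
Notation "x ∈ y" := (mem x y) (at level 70, no associativity) : gb_scope.

(** [form m n]: formulas with [m] class variables (never quantified) and [n]
    free set variables; [fEx] binds the set variable of index [0]. *)
Inductive form (m : nat) : nat -> Type :=
| fMem n : 'I_n -> 'I_n -> form m n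
| fEq n : 'I_n -> 'I_n -> form m n
| fCls n : 'I_n -> 'I_m -> form m n
| fNeg n : form m n -> form m n
| fAnd n : form m n -> form m n -> form m n
| fEx n : form m n.+1 -> form m n.

Definition scons {A : Type} {n : nat} (x : A) (v : 'I_n -> A) : 'I_n.+1 -> A :=
  fun i => if unlift ord0 i is Some j then v j else x.

Definition pair2 {A : Type} (a b : A) : 'I_2 -> A :=
  fun i => if i == ord0 then a else b.

Fixpoint sat {M : structure} {m n : nat} (phi : form m n) :
    ('I_m -> M -> Prop) -> ('I_n -> M) -> Prop :=
  match phi with
  | fMem _ i j => fun X v => v i ∈ v j
  | fEq _ i j => fun X v => v i = v j
  | fCls _ i k => fun X v => X k (v i)
  | fNeg _ f => fun X v => ~ sat f X v
  | fAnd _ f g => fun X v => sat f X v /\ sat g X v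
  | fEx _ f => fun X v => exists x : M, sat f X (scons x v)
  end.

Section Theory.
Variable M : structure.
Implicit Types (x y z a b c f g i j n p : M) (C F I R T Z : cls M).
Implicit Types (P W S : M -> Prop).

Definition is_empty z := forall x, ~ x ∈ z.
Definition subset x y := forall z, z ∈ x -> z ∈ y.
Definition is_upair p x y := forall z, z ∈ p <-> z = x \/ z = y.
(** Kuratowski pairs *)
Definition is_pair p x y :=
  exists s d, [/\ is_upair s x x, is_upair d x y & is_upair p s d].
Definition is_succ y x := forall z, z ∈ y <-> z ∈ x \/ z = x.
Definition inductive a :=
  (forall z, is_empty z -> z ∈ a) /\
  (forall x y, x ∈ a -> is_succ y x -> y ∈ a).

Definition holds P x y := exists2 p, is_pair p x y & P p.
Definition functional P := forall x y z, holds P x y -> holds P x z -> y = z.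

(** * Gödel-Bernays set theory with global choice *)

Record GBC : Prop := {
  gb_ext : forall x y, (forall z, z ∈ x <-> z ∈ y) -> x = y;
  gb_cls_ext : forall C D : cls M, (forall x, C x <-> D x) -> C = D;
  gb_pairing : forall x y, exists p, is_upair p x y;
  gb_union : forall x, exists y, forall z, z ∈ y <-> exists2 w, w ∈ x & z ∈ w;
  gb_powerset : forall x, exists y, forall z, z ∈ y <-> subset z x;
  gb_infinity : exists a, inductive a;
  gb_foundation : forall x, (exists y, y ∈ x) ->
    exists2 y, y ∈ x & forall z, z ∈ y -> ~ z ∈ x;
  gb_replacement : forall F, functional F ->
    forall a, exists b, forall y, y ∈ b <-> exists2 x, x ∈ a & holds F x y;
  gb_comprehension : forall (k l : nat) (phi : form k l.+1)
      (X : 'I_k -> cls M) (v : 'I_l -> M),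
    exists C, forall x, C x <-> sat phi (fun d => cmem (X d)) (scons x v);
  gb_global_choice : exists2 F : cls M, functional F &
    forall x, (exists y, y ∈ x) -> exists2 y, y ∈ x & holds F x y
}.

(** * Class relations; a relation [R] is a class of ordered pairs *)

Definition relation_on I R :=
  forall p, R p -> exists a b, [/\ I a, I b & is_pair p a b].

Definition class_well_founded I R :=
  forall C, (forall x, C x -> I x) -> (exists x, C x) ->
    exists2 x, C x & forall y, C y -> ~ holds R y x.

Definition class_well_order I R :=
  [/\ relation_on I R,
      (forall a b c, I a -> I b -> I c ->
         holds R a b -> holds R b c -> holds R a c),
      (forall a b, I a -> I b -> [\/ holds R a b, a = b | holds R b a])
    & class_well_founded I R].

Definition slice P b : M -> Prop := fun x => holds P b x.

Definition restrict P I R b : M -> Prop :=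
  fun p => P p /\ exists c x, [/\ I c, holds R c b & is_pair p c x].

(** * Elementary transfinite recursion

    In [phi] the set variables 0, 1 are [x], [b] and the class variables 0, 1
    are the restriction of [F] below [b], and [Z]. *)

Definition ETR :=
  forall I R, relation_on I R -> class_well_founded I R ->
  forall (phi : form 2 2) Z,
  exists F,
    (forall p, F p -> exists b x, I b /\ is_pair p b x) /\
    (forall b, I b -> forall x,
       slice F b x <->
       sat phi (pair2 (restrict F I R b) (cmem Z)) (pair2 x b)).

(** * Satisfaction classes

    Formulas are coded by sets of the structure, so that an ω-nonstandard
    structure also has nonstandard formulas.  Variables are indexed by the
    natural numbers of the structure, and the tags are its numerals:
    - [v_i ∈ v_j] is [⟨0, i, j⟩],  [v_i = v_j] is [⟨1, i, j⟩];
    - [Z v_i] is [⟨2, i⟩],  [W v_i] is [⟨3, i⟩], for the two added predicates;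
    - [¬ f] is [⟨4, f⟩],  [f ∧ g] is [⟨5, f, g⟩],  [∃ v_n, f] is [⟨6, n, f⟩]. *)

Definition is_nat n := forall a, inductive a -> n ∈ a.

Fixpoint is_numeral (k : nat) n : Prop :=
  if k is k'.+1 then exists2 m, is_numeral k' m & is_succ n m else is_empty n.

Definition tagged1 (k : nat) c x := exists2 t, is_numeral k t & is_pair c t x.
Definition tagged2 (k : nat) c x y := exists2 q, is_pair q x y & tagged1 k c q.

Definition code_mem c i j := tagged2 0 c i j.
Definition code_eq c i j := tagged2 1 c i j.
Definition code_Z c i := tagged1 2 c i.
Definition code_W c i := tagged1 3 c i.
Definition code_neg c f := tagged1 4 c f.
Definition code_and c f g := tagged2 5 c f g.
Definition code_ex c n f := tagged2 6 c n f.

Record formula_closed a : Prop := {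
  fc_mem : forall c i j, is_nat i -> is_nat j -> code_mem c i j -> c ∈ a;
  fc_eq : forall c i j, is_nat i -> is_nat j -> code_eq c i j -> c ∈ a;
  fc_Z : forall c i, is_nat i -> code_Z c i -> c ∈ a;
  fc_W : forall c i, is_nat i -> code_W c i -> c ∈ a;
  fc_neg : forall c f, f ∈ a -> code_neg c f -> c ∈ a;
  fc_and : forall c f g, f ∈ a -> g ∈ a -> code_and c f g -> c ∈ a;
  fc_ex : forall c n f, is_nat n -> f ∈ a -> code_ex c n f -> c ∈ a
}.

Definition is_formula f := forall a, formula_closed a -> f ∈ a.

Definition value a n x := holds (fun p => p ∈ a) n x.

(** Assignments are the set functions with domain ω. *)
Definition is_assignment a :=
  (forall p, p ∈ a -> exists n x, is_nat n /\ is_pair p n x) /\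
  (forall n, is_nat n -> exists! x, value a n x).

Definition variant n a b :=
  forall m : M, is_nat m -> m <> n -> forall x, value a m x <-> value b m x.

(** [S] is a satisfaction class for the structure [⟨V, ∈, Z, W⟩]. *)
Record satisfaction_class (Z W S : M -> Prop) : Prop := {
  sc_pairs : forall p, S p ->
    exists f a, [/\ is_formula f, is_assignment a & is_pair p f a];
  sc_mem : forall c i j a, is_nat i -> is_nat j -> code_mem c i j ->
    is_assignment a ->
    (holds S c a <-> exists x y, [/\ value a i x, value a j y & x ∈ y]);
  sc_eq : forall c i j a, is_nat i -> is_nat j -> code_eq c i j ->
    is_assignment a ->
    (holds S c a <-> exists x y, [/\ value a i x, value a j y & x = y]);
  sc_Z : forall c i a, is_nat i -> code_Z c i -> is_assignment a ->
    (holds S c a <-> exists2 x, value a i x & Z x);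
  sc_W : forall c i a, is_nat i -> code_W c i -> is_assignment a ->
    (holds S c a <-> exists2 x, value a i x & W x);
  sc_neg : forall c f a, is_formula f -> code_neg c f -> is_assignment a ->
    (holds S c a <-> ~ holds S f a);
  sc_and : forall c f g a, is_formula f -> is_formula g -> code_and c f g ->
    is_assignment a ->
    (holds S c a <-> holds S f a /\ holds S g a);
  sc_ex : forall c n f a, is_nat n -> is_formula f -> code_ex c n f ->
    is_assignment a ->
    (holds S c a <->
     exists b, [/\ is_assignment b, variant n a b & holds S f b])
}.

Definition iterated_truth_predicate I R Z T :=
  forall i, I i ->
    satisfaction_class (cmem Z) (restrict T I R i) (slice T i).

Definition iterated_truth :=
  forall Z I R, class_well_order I R ->
  exists T, iterated_truth_predicate I R Z T.

End Theory.

(* Main.v *)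
From Stdlib Require Import Setoid Morphisms ClassicalEpsilon FunctionalExtensionality PropExtensionality.
From mathcomp Require Import all_boot.
Require Import Defs.

(** From [ETR] to truth: recurse along [I × Formulas], where [(j,g)] precedes
    [(i,f)] when [j] precedes [i], or [j = i] and [g] is an immediate subformula
    of [f]; the step is Tarski's definition of truth.

    From truth to [ETR]: a class well-founded relation [R] need not have a rank
    function, so [R] is replaced by the tree of its finite descending sequences
    under the Kleene-Brouwer order, which is a class well-order because global
    choice yields a well-order of the universe (rank first, and Zermelo's
    well-order of each [P(V_α)] inside a rank).  Take an iterated truth predicate
    along that tree.  The recursion clause at a sequence [s] is expressed by a
    single formula [psi(x, s, c)] that reads the values at the children of [s]
    off the earlier truth predicates at the code [c]; substituting for [c] the
    code of [psi] itself closes the recursion, without a diagonal lemma.  By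
    well-foundedness the solution at [s] depends only on the last entry of [s],
    so it descends to a solution along [R]. *)

Set Implicit Arguments.
Unset Strict Implicit.
Unset Printing Implicit Defensive.

(** Class existence shapes every step. A class comes only from a formula without class quantifiers,
    so each induction, minimal counterexample or recursion along ω carries the obligation that the
    property involved is definable; the tactic [dfn] discharges most of these.

    The naturals of the structure may be nonstandard, so a satisfaction class also decides codes
    that come from no term of [form]. Building truth therefore needs induction over codes inside the
    structure. Using truth evaluates only one standard code, that of [psi], and there induction on
    [form] is enough.

    Passing to the tree has a price: different sequences with the same last entry carry separately
    computed values. Their agreement is proved by taking an [R]-minimal entry of disagreement. This
    is legitimate because all values are read off the single class [T] at one fixed code, which
    makes disagreement a definable property of the entry. *)

(** Bundled, so that the axioms are recovered from the carrier by unification. *)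
Record gbc := GBModel { model :> structure; modelP : GBC model }.

(** * Congruence and renaming for formulas *)

#[global] Instance and3_iff :
  Proper (iff ==> iff ==> iff ==> iff)%signature and3.
Proof. by move=> a a' ha b b' hb c c' hc; split=> -[? ? ?]; split; tauto. Qed.

#[global] Instance or3_iff :
  Proper (iff ==> iff ==> iff ==> iff)%signature or3.
Proof.
by move=> a a' ha b b' hb c c' hc; split=> -[] h; [constructor 1|constructor 2|constructor 3
  |constructor 1|constructor 2|constructor 3]; tauto.
Qed.

#[global] Instance and4_iff :
  Proper (iff ==> iff ==> iff ==> iff ==> iff)%signature and4.
Proof. by move=> a a' ha b b' hb c c' hc d d' hd; split=> -[? ? ? ?]; split; tauto. Qed.

Lemma sat_ext (M : structure) m n (phi : form m n) (X Y : 'I_m -> M -> Prop) v w :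
  (forall k x, X k x <-> Y k x) -> v =1 w -> sat phi X v <-> sat phi Y w.
Proof.
move=> hX hv; suff [-> ->] : X = Y /\ v = w by [].
split; apply: functional_extensionality => // k.
by apply: functional_extensionality => x; apply: propositional_extensionality.
Qed.

Lemma scons0 A n (x : A) (v : 'I_n -> A) : scons x v ord0 = x.
Proof. by rewrite /scons unlift_none. Qed.

Lemma sconsS A n (x : A) (v : 'I_n -> A) i : scons x v (lift ord0 i) = v i.
Proof. by rewrite /scons liftK. Qed.

Definition fcat A a b (f : 'I_a -> A) (g : 'I_b -> A) : 'I_(a + b) -> A :=
  fun i => match split i with inl j => f j | inr j => g j end.

Lemma fcatl A a b (f : 'I_a -> A) (g : 'I_b -> A) i : fcat f g (lshift b i) = f i.
Proof. by rewrite /fcat (unsplitK (inl i)). Qed.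

Lemma fcatr A a b (f : 'I_a -> A) (g : 'I_b -> A) i : fcat f g (rshift a i) = g i.
Proof. by rewrite /fcat (unsplitK (inr i)). Qed.

Definition lift_ren n n' (s : 'I_n -> 'I_n') : 'I_n.+1 -> 'I_n'.+1 :=
  scons ord0 (fun i => lift ord0 (s i)).

Fixpoint rename m n (phi : form m n) m' :
    forall n', ('I_m -> 'I_m') -> ('I_n -> 'I_n') -> form m' n' :=
  match phi with
  | fMem _ i j => fun n' r s => fMem m' (s i) (s j)
  | fEq _ i j => fun n' r s => fEq m' (s i) (s j)
  | fCls _ i k => fun n' r s => fCls (s i) (r k)
  | fNeg _ f => fun n' r s => fNeg (rename f r s)
  | fAnd _ f g => fun n' r s => fAnd (rename f r s) (rename g r s)
  | fEx _ f => fun n' r s => fEx (rename f r (lift_ren s))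
  end.

Lemma scons_lift_ren A n n' (s : 'I_n -> 'I_n') (x : A) v :
  (fun i => scons x v (lift_ren s i)) = scons x (fun i => v (s i)).
Proof.
apply: functional_extensionality => i; rewrite /lift_ren.
by case: (unliftP ord0 i) => [j|] ->; rewrite ?(sconsS, scons0).
Qed.

Lemma sat_rename (M : structure) m n (phi : form m n) m' n'
    (r : 'I_m -> 'I_m') (s : 'I_n -> 'I_n') (X : 'I_m' -> M -> Prop) v :
  sat (rename phi r s) X v <-> sat phi (fun k => X (r k)) (fun i => v (s i)).
Proof.
elim: phi n' s v => //= [{}n f IH|{}n f IHf g IHg|{}n f IH] n' s v.
- by rewrite IH.
- by rewrite IHf IHg.
- by split=> -[x hx]; exists x; move: hx; rewrite IH scons_lift_ren.
Qed.

(** * Uniform definability *)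

(** [dfn P]: the family [P] of relations on [M], indexed by [E], is uniformly
    first-order definable from the classes [ci c e] and the parameters [ui u e].
    Free variables are looked up in an environment [nat -> M] so that bound
    variables can be shifted by computation. *)
Section Definability.
Variables (M : structure) (E CI UI : Type).
Variables (ci : CI -> E -> M -> Prop) (ui : UI -> E -> M).
Implicit Types (P Q : E -> (nat -> M) -> Prop) (t : E -> (nat -> M) -> M).

Inductive atom := Var of nat | Cst of UI.
Definition atomv a e (v : nat -> M) :=
  match a with Var j => v j | Cst u => ui u e end.

Definition dfn P := exists k n (cs : 'I_k -> CI) (ts : 'I_n -> atom) (phi : form k n),
  forall e v, sat phi (fun c => ci (cs c) e) (fun i => atomv (ts i) e v) <-> P e v.

(** The syntax has no terms, so a term is definable when its graph is: position 0 holds the value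
    and the variables of [t] are shifted by one. *)
Definition tfn t := dfn (fun e w => w 0 = t e (fun i => w i.+1)).

Lemma dfn_iff P Q : (forall e v, P e v <-> Q e v) -> dfn P -> dfn Q.
Proof. by move=> h [k [n [cs [ts [phi hp]]]]]; exists k, n, cs, ts, phi => e v; rewrite hp. Qed.

Lemma dfn_not P : dfn P -> dfn (fun e v => ~ P e v).
Proof. by move=> [k [n [cs [ts [phi hp]]]]]; exists k, n, cs, ts, (fNeg phi) => e v /=; rewrite hp. Qed.

Lemma dfn_and P Q : dfn P -> dfn Q -> dfn (fun e v => P e v /\ Q e v).
Proof.
move=> [k [n [cs [ts [phi hp]]]]] [k' [n' [cs' [ts' [psi hq]]]]].
exists (k + k'), (n + n'), (fcat cs cs'), (fcat ts ts').
exists (fAnd (rename phi (@lshift k k') (@lshift n n')) (rename psi (@rshift k k') (@rshift n n'))).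
move=> e v /=; rewrite !sat_rename -hp -hq.
rewrite (@sat_ext _ _ _ phi _ (fun c => ci (cs c) e) _ (fun i => atomv (ts i) e v));
  [|by move=> c x; rewrite fcatl|by move=> i; rewrite fcatl].
by rewrite (@sat_ext _ _ _ psi _ (fun c => ci (cs' c) e) _ (fun i => atomv (ts' i) e v));
  [|move=> c x; rewrite fcatr|move=> i; rewrite fcatr].
Qed.

Lemma dfn_ex (P : E -> (nat -> M) -> M -> Prop) :
  dfn (fun e w => P e (fun i => w i.+1) (w 0)) -> dfn (fun e v => exists x, P e v x).
Proof.
move=> [k [n [cs [ts [phi hp]]]]].
(* Several variables of [phi] may look up position 0; all are merged into the bound variable. The
   lookup [Var 0.-1] left for them below is a dummy that is never read. *)
pose s (i : 'I_n) : 'I_n.+1 := if ts i is Var 0 then ord0 else lift ord0 i.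
exists k, n, cs, (fun i => if ts i is Var j then Var j.-1 else ts i), (fEx (rename phi id s)).
suff h x e v : sat (rename phi id s) (fun c => ci (cs c) e)
    (scons x (fun i => atomv (if ts i is Var j then Var j.-1 else ts i) e v)) <-> P e v x.
  by move=> e v /=; split=> -[x /h hx]; exists x.
pose w i := if i is j.+1 then v j else x.
rewrite sat_rename -[P e v x]/(P e (fun i => w i.+1) (w 0)) -hp; apply: sat_ext => // i.
by rewrite /s; case h: (ts i) => [[|j]|u]; rewrite ?scons0 ?sconsS ?h.
Qed.

Lemma dfn_ren P (r : nat -> nat) : dfn P -> dfn (fun e v => P e (fun i => v (r i))).
Proof.
move=> [k [n [cs [ts [phi hp]]]]].
exists k, n, cs, (fun i => if ts i is Var j then Var (r j) else ts i), phi => e v.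
by rewrite -hp; apply: sat_ext => // i; case: (ts i).
Qed.

Lemma tfn_ren t (r : nat -> nat) : tfn t -> tfn (fun e v => t e (fun i => v (r i))).
Proof. exact: (@dfn_ren _ (fun i => if i is j.+1 then (r j).+1 else 0)). Qed.

(** Substitution is expressed as ∃ x, x = t ∧ P x, so no syntactic substitution is required. *)
Lemma dfn_sub (P : E -> M -> (nat -> M) -> Prop) t :
  dfn (fun e w => P e (w 0) (fun i => w i.+1)) -> tfn t -> dfn (fun e v => P e (t e v) v).
Proof.
move=> hP ht; apply: (@dfn_iff (fun e v => exists x, x = t e v /\ P e x v)).
  by move=> e v; split=> [[x [-> //]]|h]; exists (t e v).
exact/dfn_ex/dfn_and.
Qed.

(** The connectives of [form] are only ¬, ∧ and ∃; this one and those below are recovered from them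
    classically. *)
Lemma dfn_or P Q : dfn P -> dfn Q -> dfn (fun e v => P e v \/ Q e v).
Proof.
move=> hP hQ; apply: (dfn_iff _ (dfn_not (dfn_and (dfn_not hP) (dfn_not hQ)))) => e v.
split=> [h|h [h1 h2]]; last by case: h.
by apply: NNPP => h'; apply: h; split=> h1; apply: h'; [left|right].
Qed.

Lemma dfn_imp P Q : dfn P -> dfn Q -> dfn (fun e v => P e v -> Q e v).
Proof.
move=> hP hQ; apply: (dfn_iff _ (dfn_not (dfn_and hP (dfn_not hQ)))) => e v.
split=> [h h1|h [h1 h2]]; last exact/h2/h.
by apply: NNPP => h'; apply: h.
Qed.

Lemma dfn_iff2 P Q : dfn P -> dfn Q -> dfn (fun e v => P e v <-> Q e v).
Proof. by move=> hP hQ; apply: dfn_and; apply: dfn_imp. Qed.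

Lemma dfn_all (P : E -> (nat -> M) -> M -> Prop) :
  dfn (fun e w => P e (fun i => w i.+1) (w 0)) -> dfn (fun e v => forall x, P e v x).
Proof.
move=> /dfn_not h.
apply: (dfn_iff _ (dfn_not (@dfn_ex (fun e v x => ~ P e v x) h))) => e v.
split=> [h1 x|h1 [x]]; last by apply; apply: h1.
by apply: NNPP => h2; apply: h1; exists x.
Qed.

Lemma dfn_ex2 (P Q : E -> (nat -> M) -> M -> Prop) :
  dfn (fun e w => P e (fun i => w i.+1) (w 0)) ->
  dfn (fun e w => Q e (fun i => w i.+1) (w 0)) ->
  dfn (fun e v => exists2 x, P e v x & Q e v x).
Proof.
move=> hP hQ; apply: (dfn_iff _ (@dfn_ex (fun e v x => P e v x /\ Q e v x) (dfn_and hP hQ))).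
by move=> e v; split=> [[x []]|[x]]; exists x.
Qed.

Lemma dfn_and3 P Q R : dfn P -> dfn Q -> dfn R -> dfn (fun e v => [/\ P e v, Q e v & R e v]).
Proof.
move=> hP hQ hR; apply: (dfn_iff _ (dfn_and hP (dfn_and hQ hR))).
by move=> e v; split=> [[? []]|[]].
Qed.

Lemma dfn_or3 P Q R : dfn P -> dfn Q -> dfn R -> dfn (fun e v => [\/ P e v, Q e v | R e v]).
Proof.
move=> hP hQ hR; apply: (dfn_iff _ (dfn_or hP (dfn_or hQ hR))) => e v.
split=> [[h|[h|h]]|[h|h|h]];
  [constructor 1|constructor 2|constructor 3|left|right; left|right; right]; exact: h.
Qed.

Lemma dfn_or4 P Q R S : dfn P -> dfn Q -> dfn R -> dfn S ->
  dfn (fun e v => [\/ P e v, Q e v, R e v | S e v]).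
Proof.
move=> hP hQ hR hS; apply: (dfn_iff _ (dfn_or hP (dfn_or3 hQ hR hS))) => e v.
split=> [[h|[h|h|h]]|[h|h|h|h]];
  [constructor 1|constructor 2|constructor 3|constructor 4|left
  |right; constructor 1|right; constructor 2|right; constructor 3]; exact: h.
Qed.

Lemma dfn_and4 P Q R S : dfn P -> dfn Q -> dfn R -> dfn S ->
  dfn (fun e v => [/\ P e v, Q e v, R e v & S e v]).
Proof.
move=> hP hQ hR hS; apply: (dfn_iff _ (dfn_and hP (dfn_and3 hQ hR hS))).
by move=> e v; split=> [[? []]|[]].
Qed.

Lemma dfn_eq_atom a b : dfn (fun e v => atomv a e v = atomv b e v).
Proof.
exists 0, 2, (fun i : 'I_0 => match i with Ordinal _ p => False_rect CI (notF p) end).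
by exists (pair2 a b), (fEq 0 ord0 (lift ord0 ord0)).
Qed.

Lemma dfn_mem_atom a b : dfn (fun e v => atomv a e v ∈ atomv b e v).
Proof.
exists 0, 2, (fun i : 'I_0 => match i with Ordinal _ p => False_rect CI (notF p) end).
by exists (pair2 a b), (fMem 0 ord0 (lift ord0 ord0)).
Qed.

Lemma dfn_cls_atom c a : dfn (fun e v => ci c e (atomv a e v)).
Proof. by exists 1, 1, (fun=> c), (fun=> a), (fCls ord0 ord0). Qed.

Lemma tfn_var i : tfn (fun e v => v i).
Proof. exact: (dfn_eq_atom (Var 0) (Var i.+1)). Qed.

Lemma tfn_cst u : tfn (fun e v => ui u e).
Proof. exact: (dfn_eq_atom (Var 0) (Cst u)). Qed.

Lemma dfn_false : dfn (fun _ _ => False).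
Proof.
by apply: (dfn_iff _ (dfn_not (dfn_eq_atom (Var 0) (Var 0)))) => e v; split=> [[]|[]].
Qed.

Lemma dfn_sub1 (P : E -> M -> Prop) t :
  dfn (fun e v => P e (v 0)) -> tfn t -> dfn (fun e v => P e (t e v)).
Proof. exact: (@dfn_sub (fun e x _ => P e x)). Qed.

Lemma dfn_sub2 (P : E -> M -> M -> Prop) t1 t2 :
  dfn (fun e v => P e (v 0) (v 1)) -> tfn t1 -> tfn t2 ->
  dfn (fun e v => P e (t1 e v) (t2 e v)).
Proof.
move=> h h1 h2; apply: (@dfn_sub (fun e x v => P e x (t2 e v)) _ _ h1).
apply: (@dfn_sub (fun e y w => P e (w 0) y)).
  by apply: (@dfn_ren (fun e v => P e (v 0) (v 1)) (fun i => if i is 0 then 1 else 0)).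
exact: tfn_ren h2.
Qed.

Lemma dfn_sub3 (P : E -> M -> M -> M -> Prop) t1 t2 t3 :
  dfn (fun e v => P e (v 0) (v 1) (v 2)) -> tfn t1 -> tfn t2 -> tfn t3 ->
  dfn (fun e v => P e (t1 e v) (t2 e v) (t3 e v)).
Proof.
move=> h h1 h2 h3; apply: (@dfn_sub (fun e x v => P e x (t2 e v) (t3 e v)) _ _ h1).
apply: (@dfn_sub (fun e y w => P e (w 0) y (t3 e (fun i => w i.+1)))); last exact: tfn_ren h2.
apply: (@dfn_sub (fun e z w => P e (w 1) (w 0) z)).
  (* The three values were pushed one after the other, so the environment lists them in reverse
     order. *)
  by apply: (@dfn_ren (fun e v => P e (v 0) (v 1) (v 2)) (fun i => 2 - i)).
exact: (tfn_ren (fun i => i.+2)) h3.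
Qed.

Lemma dfn_mem t1 t2 : tfn t1 -> tfn t2 -> dfn (fun e v => t1 e v ∈ t2 e v).
Proof. exact: (@dfn_sub2 (fun _ x y => x ∈ y)) (dfn_mem_atom (Var 0) (Var 1)). Qed.

Lemma dfn_eq t1 t2 : tfn t1 -> tfn t2 -> dfn (fun e v => t1 e v = t2 e v).
Proof. exact: (@dfn_sub2 (fun _ x y => x = y)) (dfn_eq_atom (Var 0) (Var 1)). Qed.

Lemma dfn_cls c t : tfn t -> dfn (fun e v => ci c e (t e v)).
Proof. exact: (@dfn_sub1 (fun e x => ci c e x)) (dfn_cls_atom c (Var 0)). Qed.

Lemma tfn_fun1 (f : E -> M -> M) t :
  dfn (fun e v => v 0 = f e (v 1)) -> tfn t -> tfn (fun e v => f e (t e v)).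
Proof. by move=> h ht; apply: (@dfn_sub2 (fun e x y => x = f e y) (fun e w => w 0));
  [exact: h | exact: tfn_var | exact: tfn_ren ht]. Qed.

Lemma tfn_fun2 (f : E -> M -> M -> M) t1 t2 :
  dfn (fun e v => v 0 = f e (v 1) (v 2)) -> tfn t1 -> tfn t2 ->
  tfn (fun e v => f e (t1 e v) (t2 e v)).
Proof. by move=> h ht ht'; apply: (@dfn_sub3 (fun e x y z => x = f e y z) (fun e w => w 0));
  [exact: h | exact: tfn_var | exact: tfn_ren ht | exact: tfn_ren ht']. Qed.

End Definability.

(** The index type is trivial, and all classes and sets of the structure are allowed as parameters:
    these are exactly the instances that comprehension accepts. *)
Notation pdef P := (dfn (fun C (_ : unit) => cmem C) (fun a _ => a) (fun _ v => P v)).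
Notation ptfn t := (tfn (fun C (_ : unit) => cmem C) (fun a _ => a) (fun _ v => t v)).

(** A hook, redefined whenever a new batch of closure lemmas becomes available. *)
Ltac dfn_extra := fail.
Ltac dfn_step := first
 [ assumption
 | match goal with
   | |- tfn _ _ (fun _ v => v _) => apply: tfn_var
   | |- tfn _ (fun a _ => a) (fun _ _ => ?a) => exact: (@tfn_cst _ _ _ _ _ _ a)
   | |- dfn _ _ (fun _ _ => cmem ?K _) =>
       apply: (@dfn_cls _ _ _ _ (fun C _ => cmem C) _ K)
   | |- dfn _ _ (fun _ _ => False) => apply: dfn_false
   | |- dfn _ _ (fun _ _ => _ /\ _) => apply: dfn_and
   | |- dfn _ _ (fun _ _ => _ \/ _) => apply: dfn_or
   | |- dfn _ _ (fun _ _ => _ <-> _) => apply: dfn_iff2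
   | |- dfn _ _ (fun _ _ => ~ _) => apply: dfn_not
   | |- dfn _ _ (fun _ _ => or3 _ _ _) => apply: dfn_or3
   | |- dfn _ _ (fun _ _ => or4 _ _ _ _) => apply: dfn_or4
   | |- dfn _ _ (fun _ _ => and3 _ _ _) => apply: dfn_and3
   | |- dfn _ _ (fun _ _ => and4 _ _ _ _) => apply: dfn_and4
   | |- dfn _ _ (fun _ _ => exists x, _) => apply: dfn_ex
   | |- dfn _ _ (fun _ _ => exists2 x, _ & _) => apply: dfn_ex2
   | |- dfn _ _ (fun _ _ => _ ∈ _) => apply: dfn_mem
   | |- dfn _ _ (fun _ _ => _ = _) => apply: dfn_eq
   | |- dfn _ _ (fun _ _ => _ -> _) => apply: dfn_imp
   | |- dfn _ _ (fun _ _ => forall x, _) => apply: dfn_all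
   end
 | dfn_extra
 | apply: (@dfn_cls _ _ _ _ (fun i X => X i) _ _) ].
Ltac dfn := repeat (cbv beta; dfn_step).

(** * Definability of basic set-theoretic predicates *)

Section DefinablePredicates.
Variables (M : structure) (E CI UI : Type).
Variables (ci : CI -> E -> M -> Prop) (ui : UI -> E -> M).
Implicit Types (t : E -> (nat -> M) -> M).

Lemma dfn_subset t1 t2 : tfn ci ui t1 -> tfn ci ui t2 ->
  dfn ci ui (fun e v => subset (t1 e v) (t2 e v)).
Proof. by apply: (@dfn_sub2 _ _ _ _ _ _ (fun _ => @subset M)); rewrite /subset; dfn. Qed.

Lemma dfn_is_empty t1 : tfn ci ui t1 -> dfn ci ui (fun e v => is_empty (t1 e v)).
Proof. by apply: (@dfn_sub1 _ _ _ _ _ _ (fun _ => @is_empty M)); rewrite /is_empty; dfn. Qed.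

Lemma dfn_is_succ t1 t2 : tfn ci ui t1 -> tfn ci ui t2 ->
  dfn ci ui (fun e v => is_succ (t1 e v) (t2 e v)).
Proof. by apply: (@dfn_sub2 _ _ _ _ _ _ (fun _ => @is_succ M)); rewrite /is_succ; dfn. Qed.

Lemma dfn_is_upair t1 t2 t3 : tfn ci ui t1 -> tfn ci ui t2 -> tfn ci ui t3 ->
  dfn ci ui (fun e v => is_upair (t1 e v) (t2 e v) (t3 e v)).
Proof. by apply: (@dfn_sub3 _ _ _ _ _ _ (fun _ => @is_upair M)); rewrite /is_upair; dfn. Qed.

Lemma dfn_is_pair t1 t2 t3 : tfn ci ui t1 -> tfn ci ui t2 -> tfn ci ui t3 ->
  dfn ci ui (fun e v => is_pair (t1 e v) (t2 e v) (t3 e v)).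
Proof.
by apply: (@dfn_sub3 _ _ _ _ _ _ (fun _ => @is_pair M)); rewrite /is_pair; dfn;
  apply: dfn_is_upair; dfn.
Qed.

Lemma dfn_is_nat t1 : tfn ci ui t1 -> dfn ci ui (fun e v => is_nat (t1 e v)).
Proof.
by apply: (@dfn_sub1 _ _ _ _ _ _ (fun _ => @is_nat M)); rewrite /is_nat /inductive; dfn;
  [apply: dfn_is_empty | apply: dfn_is_succ]; dfn.
Qed.

Lemma dfn_is_numeral k t1 : tfn ci ui t1 -> dfn ci ui (fun e v => is_numeral k (t1 e v)).
Proof.
apply: (@dfn_sub1 _ _ _ _ _ _ (fun _ => @is_numeral M k)).
elim: k => [|k IH] /=; first by apply: dfn_is_empty; dfn.
by dfn; apply: dfn_is_succ; dfn.
Qed.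

End DefinablePredicates.

Ltac dfn_extra_basic := match goal with
 | |- dfn _ _ (fun _ _ => subset _ _) => apply: dfn_subset
 | |- dfn _ _ (fun _ _ => is_empty _) => apply: dfn_is_empty
 | |- dfn _ _ (fun _ _ => is_succ _ _) => apply: dfn_is_succ
 | |- dfn _ _ (fun _ _ => is_upair _ _ _) => apply: dfn_is_upair
 | |- dfn _ _ (fun _ _ => is_pair _ _ _) => apply: dfn_is_pair
 | |- dfn _ _ (fun _ _ => is_nat _) => apply: dfn_is_nat
 | |- dfn _ _ (fun _ _ => is_numeral _ _) => apply: dfn_is_numeral
 | |- dfn _ _ (fun _ _ => holds _ _ _) => rewrite /holds
 | |- dfn _ _ (fun _ _ => value _ _ _) => rewrite /value
 | |- dfn _ _ (fun _ _ => slice _ _ _) => rewrite /slice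
 | |- dfn _ _ (fun _ _ => restrict _ _ _ _ _) => rewrite /restrict
 end.
Ltac dfn_extra ::= dfn_extra_basic.

(** * Sets and natural numbers *)

Section BasicSets.
Context {M : gbc}.
Implicit Types (x y z a b c : M).

Lemma inhabited_sets : inhabited M.
Proof. by have [a _] := gb_infinity (modelP M). Qed.

(** Choice in the metatheory names the sets that the axioms provide. It says nothing about
    definability, which the [tfn] lemmas derive from the characteristic property of each
    operation. *)
Definition eps (P : M -> Prop) : M := epsilon inhabited_sets P.

Lemma epsP (P : M -> Prop) : (exists x, P x) -> P (eps P).
Proof. exact: epsilon_spec. Qed.

Lemma comprehension (P : M -> Prop) :
  pdef (fun v => P (v 0)) -> exists C : cls M, forall x, C x <-> P x.
Proof.
move=> [k [n [cs [ts [phi h]]]]]; have [d] := inhabited_sets.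
pose s (i : 'I_n) : 'I_n.+1 := if ts i is Var 0 then ord0 else lift ord0 i.
(* Only position 0 of the environment matters to [P]; the arbitrary set [d] fills all others. *)
have [C hC] := gb_comprehension (modelP M) (rename phi id s) cs (fun i => atomv (fun a _ => a) (ts i) tt (fun=> d)).
exists C => x; rewrite hC sat_rename -(h tt (fun i => if i is 0 then x else d)).
apply: sat_ext => // i; rewrite /s.
by case e: (ts i) => [[|j]|u]; rewrite ?scons0 ?sconsS ?e.
Qed.

Lemma set_ext x y : (forall z, z ∈ x <-> z ∈ y) -> x = y.
Proof. exact: (gb_ext (modelP M)). Qed.

Definition upair x y := eps (fun p => is_upair p x y).
Definition bigU x := eps (fun y => forall z, z ∈ y <-> exists2 w, w ∈ x & z ∈ w).
Definition pow x := eps (fun y => forall z, z ∈ y <-> subset z x).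
Definition sep a (P : M -> Prop) := eps (fun b => forall z, z ∈ b <-> z ∈ a /\ P z).
Definition img (f : M -> M) a := eps (fun b => forall y, y ∈ b <-> exists2 x, x ∈ a & y = f x).
Definition opair x y := upair (upair x x) (upair x y).
Definition union2 x y := bigU (upair x y).
Definition succ x := union2 x (upair x x).

Lemma in_upair z x y : z ∈ upair x y <-> z = x \/ z = y.
Proof. exact: (epsP (gb_pairing (modelP M) x y)). Qed.

Lemma in_bigU z x : z ∈ bigU x <-> exists2 w, w ∈ x & z ∈ w.
Proof. exact: (epsP (gb_union (modelP M) x)). Qed.

Lemma in_pow z x : z ∈ pow x <-> subset z x.
Proof. exact: (epsP (gb_powerset (modelP M) x)). Qed.

Lemma is_upairE p x y : is_upair p x y <-> p = upair x y.
Proof.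
split=> [h|->]; last by move=> z; exact: in_upair.
by apply: set_ext => z; rewrite h in_upair.
Qed.

Lemma is_pairE p x y : is_pair p x y <-> p = opair x y.
Proof.
split=> [[s [d []]]|->]; first by rewrite !is_upairE => -> -> ->.
by exists (upair x x), (upair x y); rewrite !is_upairE.
Qed.

Lemma upair1_inj x y : upair x x = upair y y -> x = y.
Proof.
by move=> h; have := in_upair x y y; rewrite -h in_upair; case=> [+ _] => /(_ (or_introl erefl)) [].
Qed.

Lemma pair_inj x y x' y' : opair x y = opair x' y' -> x = x' /\ y = y'.
Proof.
move=> h.
have h1 a b c d : opair a b = opair c d -> a = c.
  move=> e; have : upair a a ∈ opair c d by rewrite -e in_upair; left.
  rewrite in_upair => -[/upair1_inj //|e2].
  have : c ∈ upair a a by rewrite e2 in_upair; left.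
  by rewrite in_upair => -[].
have ex := h1 _ _ _ _ h; split=> //; subst x'.
have h2 b d : opair x b = opair x d -> b = d \/ b = x.
  move=> e; have : upair x b ∈ opair x d by rewrite -e in_upair; right.
  rewrite in_upair => -[] e2.
    have : b ∈ upair x x by rewrite -e2 in_upair; right.
    by rewrite in_upair => -[]; right.
  have : b ∈ upair x d by rewrite -e2 in_upair; right.
  by rewrite in_upair => -[]; [right|left].
case: (h2 _ _ h) => // ey; case: (h2 _ _ (esym h)) => // ey'; congruence.
Qed.

Lemma holdsE (P : M -> Prop) x y : holds P x y <-> P (opair x y).
Proof.
by split=> [[p /is_pairE -> //]|h]; exists (opair x y) => //; rewrite is_pairE.
Qed.

Lemma valueE a n x : value a n x <-> opair n x ∈ a.
Proof. exact: holdsE. Qed.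

Lemma in_union2 z x y : z ∈ union2 x y <-> z ∈ x \/ z ∈ y.
Proof.
rewrite in_bigU; split=> [[w]|[h|h]].
- by rewrite in_upair => -[-> | ->]; [left|right].
- by exists x => //; rewrite in_upair; left.
- by exists y => //; rewrite in_upair; right.
Qed.

Lemma in_succ z x : z ∈ succ x <-> z ∈ x \/ z = x.
Proof. by rewrite in_union2 in_upair; tauto. Qed.

Lemma is_succE y x : is_succ y x <-> y = succ x.
Proof.
split=> [h|->]; last by move=> z; exact: in_succ.
by apply: set_ext => z; rewrite h in_succ.
Qed.

Section TermDefinability.
Variables (E CI UI : Type) (ci : CI -> E -> M -> Prop) (ui : UI -> E -> M).
Implicit Types (t : E -> (nat -> M) -> M).

Lemma tfn_upair t1 t2 : tfn ci ui t1 -> tfn ci ui t2 ->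
  tfn ci ui (fun e v => upair (t1 e v) (t2 e v)).
Proof.
apply: (@tfn_fun2 _ _ _ _ _ _ (fun _ => upair)).
apply: (dfn_iff (P := fun e v => is_upair (v 0) (v 1) (v 2))) => [e v|]; [exact: is_upairE | dfn].
Qed.

Lemma tfn_pair t1 t2 : tfn ci ui t1 -> tfn ci ui t2 ->
  tfn ci ui (fun e v => opair (t1 e v) (t2 e v)).
Proof. by move=> h1 h2; apply: tfn_upair; apply: tfn_upair. Qed.

Lemma tfn_bigU t1 : tfn ci ui t1 -> tfn ci ui (fun e v => bigU (t1 e v)).
Proof.
apply: (@tfn_fun1 _ _ _ _ _ _ (fun _ => bigU)).
apply: (dfn_iff (P := fun e v => forall z, z ∈ v 0 <-> exists2 w, w ∈ v 1 & z ∈ w)); last by dfn.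
by move=> e v; split=> [h|-> z]; [apply: set_ext => z; rewrite h|]; rewrite in_bigU.
Qed.

Lemma tfn_pow t1 : tfn ci ui t1 -> tfn ci ui (fun e v => pow (t1 e v)).
Proof.
apply: (@tfn_fun1 _ _ _ _ _ _ (fun _ => pow)).
apply: (dfn_iff (P := fun e v => forall z, z ∈ v 0 <-> subset z (v 1))); last by dfn.
by move=> e v; split=> [h|-> z]; [apply: set_ext => z; rewrite h|]; rewrite in_pow.
Qed.

Lemma tfn_union2 t1 t2 : tfn ci ui t1 -> tfn ci ui t2 ->
  tfn ci ui (fun e v => union2 (t1 e v) (t2 e v)).
Proof. by move=> h1 h2; apply: tfn_bigU; apply: tfn_upair. Qed.

Lemma tfn_succ t1 : tfn ci ui t1 -> tfn ci ui (fun e v => succ (t1 e v)).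
Proof. by move=> h1; apply: tfn_union2 => //; apply: tfn_upair. Qed.

End TermDefinability.

End BasicSets.

Ltac dfn_extra_sets := match goal with
 | |- tfn _ _ (fun _ _ => upair _ _) => apply: tfn_upair
 | |- tfn _ _ (fun _ _ => opair _ _) => apply: tfn_pair
 | |- tfn _ _ (fun _ _ => bigU _) => apply: tfn_bigU
 | |- tfn _ _ (fun _ _ => pow _) => apply: tfn_pow
 | |- tfn _ _ (fun _ _ => union2 _ _) => apply: tfn_union2
 | |- tfn _ _ (fun _ _ => succ _) => apply: tfn_succ
 end.
Ltac dfn_extra ::= first [dfn_extra_basic | dfn_extra_sets].

(** * Natural numbers and finite sequences inside the structure *)

Section Naturals.
Context {M : gbc}.
Implicit Types (x y z a b c k m n s : M).

(** Separation is replacement for the identity function restricted to [P]. *)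
Lemma in_sep a (P : M -> Prop) z :
  pdef (fun v => P (v 0)) -> z ∈ sep a P <-> z ∈ a /\ P z.
Proof.
move=> hP; move: z; refine (epsP (P := fun b => forall z, z ∈ b <-> z ∈ a /\ P z) _).
have [F hF] : exists F : cls M, forall p, F p <-> exists x, P x /\ p = opair x x.
  by apply: comprehension; dfn.
have [|b hb] := gb_replacement (modelP M) (F := F) _ a.
  by move=> x y z; rewrite !holdsE !hF => -[u [_ /pair_inj[-> ->]]] [w [_ /pair_inj[-> ->]]].
exists b => z; rewrite hb; split=> [[x hx]|[ha hz]].
  by rewrite holdsE hF => -[u [hu /pair_inj[e ->]]]; rewrite -e in hu *.
by exists z => //; rewrite holdsE hF; exists z.
Qed.

Lemma in_img (f : M -> M) a y :
  ptfn (fun v => f (v 0)) -> y ∈ img f a <-> exists2 x, x ∈ a & y = f x.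
Proof.
move=> hf; move: y; refine (epsP (P := fun b => forall y, y ∈ b <-> exists2 x, x ∈ a & y = f x) _).
have [F hF] : exists F : cls M, forall p, F p <-> exists x, p = opair x (f x).
  by apply: comprehension; dfn.
have [|b hb] := gb_replacement (modelP M) (F := F) _ a.
  by move=> x y z; rewrite !holdsE !hF => -[u /pair_inj[-> ->]] [w /pair_inj[-> ->]].
exists b => z; rewrite hb; split=> -[x hx].
  by rewrite holdsE hF => -[u /pair_inj[e ->]]; exists x; rewrite // e.
by move=> ->; exists x => //; rewrite holdsE hF; exists x.
Qed.

Lemma not_mem_self x : ~ x ∈ x.
Proof.
move=> h; have [|y] := gb_foundation (modelP M) (x := upair x x).
  by exists x; rewrite in_upair; left.
by rewrite in_upair => -[] -> /(_ x h); rewrite in_upair; tauto.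
Qed.

Lemma not_mem_cycle x y : x ∈ y -> ~ y ∈ x.
Proof.
move=> h h'; have [|z] := gb_foundation (modelP M) (x := upair x y).
  by exists x; rewrite in_upair; left.
by rewrite in_upair => -[] -> => [/(_ y h')|/(_ x h)]; rewrite in_upair; tauto.
Qed.

Definition empty : M := eps (@is_empty M).

Lemma emptyP : is_empty empty.
Proof.
apply: epsP; have [a _] := gb_infinity (modelP M).
(* Infinity alone does not give an empty set: [inductive] only says that any empty set is a
   member. *)
exists (sep a (fun x => x <> x)) => x; rewrite in_sep; last by dfn.
by case.
Qed.

Lemma is_emptyE z : is_empty z <-> z = empty.
Proof.
split=> [h|->]; last exact: emptyP.
by apply: set_ext => x; split=> [/h|/emptyP].
Qed.

Lemma inductiveE a : inductive a <-> empty ∈ a /\ forall x, x ∈ a -> succ x ∈ a.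
Proof.
split=> -[h1 h2]; split.
- exact/h1/emptyP.
- by move=> x /h2; apply; rewrite is_succE.
- by move=> z /is_emptyE ->.
- by move=> x y /h2 h /is_succE ->.
Qed.

Lemma nat_zero : is_nat empty.
Proof. by move=> a /inductiveE []. Qed.

Lemma nat_succ n : is_nat n -> is_nat (succ n).
Proof. by move=> h a ha; move: (h a ha); apply: (proj2 (iffLR (inductiveE a) ha)). Qed.

Definition om : M := sep (eps (@inductive M)) (@is_nat M).

Lemma in_om n : n ∈ om <-> is_nat n.
Proof.
rewrite in_sep; last by dfn.
by split=> [[]//|h]; split=> //; apply: h; apply: epsP; exact: (gb_infinity (modelP M)).
Qed.

(** Definability of [P] is what makes {n ∈ ω | P n} a set; being inductive, it then contains every
    natural, including nonstandard ones. *)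
Lemma nat_ind (P : M -> Prop) : pdef (fun v => P (v 0)) ->
  P empty -> (forall n, is_nat n -> P n -> P (succ n)) -> forall n, is_nat n -> P n.
Proof.
move=> hP h0 hS n hn; suff: n ∈ sep om P by rewrite (in_sep _ _ hP) => -[].
apply: hn.
rewrite inductiveE; split=> [|x]; rewrite !(in_sep _ _ hP) !in_om; first by split=> //; apply: nat_zero.
by move=> [h1 h2]; split; [exact: nat_succ | exact: hS].
Qed.

Lemma nat_mem n m : is_nat n -> m ∈ n -> is_nat m.
Proof.
move: n; apply: (nat_ind (P := fun n => m ∈ n -> is_nat m)) => [||n hn IH]; first by dfn.
  by move/emptyP.
by rewrite in_succ => -[/IH|->].
Qed.

Lemma nat_trans n m k : is_nat n -> m ∈ n -> k ∈ m -> k ∈ n.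
Proof.
move=> + + hk; move: n; apply: (nat_ind (P := fun n => m ∈ n -> k ∈ n)) => [||n hn IH]; first by dfn.
  by move/emptyP.
by rewrite !in_succ => -[/IH|e]; left => //; rewrite -e.
Qed.

Lemma mem_succ n : n ∈ succ n.
Proof. by rewrite in_succ; right. Qed.

Lemma succ_neq0 n : succ n <> empty.
Proof. by move=> h; move: (mem_succ n); rewrite h => /emptyP. Qed.

Lemma nat_zero_in n : is_nat n -> n = empty \/ empty ∈ n.
Proof.
move: n; apply: nat_ind => [||n hn IH]; first by dfn.
  by left.
by right; rewrite in_succ; case: IH => [->|?]; [right|left].
Qed.

Lemma nat_succ_in n m : is_nat n -> m ∈ n -> succ m ∈ n \/ succ m = n.
Proof.
move: n; apply: (nat_ind (P := fun n => m ∈ n -> succ m ∈ n \/ succ m = n)) => [||n hn IH]; first by dfn.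
  by move/emptyP.
by rewrite !in_succ => -[/IH|->]; tauto.
Qed.

Lemma nat_total m n : is_nat m -> is_nat n -> [\/ m ∈ n, m = n | n ∈ m].
Proof.
move=> + hn; move: m; apply: nat_ind => [||m hm IH].
- by dfn.
- by case: (nat_zero_in hn) => [->|?]; [constructor 2|constructor 1].
case: IH => [h|->|h]; last by constructor 3; rewrite in_succ; left.
  by case: (nat_succ_in hn h); [constructor 1|constructor 2].
by constructor 3; apply: mem_succ.
Qed.

Lemma succ_inj m n : succ m = succ n -> m = n.
Proof.
move=> h; move: (mem_succ m); rewrite h in_succ => -[h1|//].
by move: (mem_succ n); rewrite -h in_succ => -[/not_mem_cycle|//].
Qed.

Lemma nat_least (P : M -> Prop) : pdef (fun v => P (v 0)) ->
  (exists2 n, is_nat n & P n) -> exists n, [/\ is_nat n, P n & forall m, m ∈ n -> ~ P m].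
Proof.
move=> hP [n hn h]; have [|m] := gb_foundation (modelP M) (x := sep om P).
  by exists n; rewrite (in_sep _ _ hP) in_om.
rewrite (in_sep _ _ hP) in_om => -[hm h1] h2; exists m; split=> // k hk h3.
by apply: (h2 k hk); rewrite (in_sep _ _ hP) in_om; split=> //; exact: nat_mem hk.
Qed.

Definition num (k : nat) : M := iter k succ empty.

Lemma is_numeralE (k : nat) n : is_numeral k n <-> n = num k.
Proof.
elim: k n => [|k IH] n /=; first exact: is_emptyE.
split=> [[m /IH -> /is_succE //]|->]; exists (num k); first exact/IH.
by rewrite is_succE.
Qed.

Lemma num_nat (k : nat) : is_nat (num k).
Proof. by elim: k => [|k]; [exact: nat_zero | exact: nat_succ]. Qed.

Lemma num_inj (j k : nat) : num j = num k -> j = k.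
Proof.
elim: j k => [|j IH] [|k] //=; [by move/esym/succ_neq0 | by move/succ_neq0 |].
by move/succ_inj/IH ->.
Qed.

Definition is_seq s n :=
  [/\ is_nat n, (forall p, p ∈ s -> exists k x, k ∈ n /\ p = opair k x),
      (forall k x y, opair k x ∈ s -> opair k y ∈ s -> x = y)
    & forall k, k ∈ n -> exists x, opair k x ∈ s].

Definition snoc s n x := union2 s (upair (opair n x) (opair n x)).

Lemma in_snoc p s n x : p ∈ snoc s n x <-> p ∈ s \/ p = opair n x.
Proof. by rewrite in_union2 in_upair; tauto. Qed.

Lemma seqn_dom s n k x : is_seq s n -> opair k x ∈ s -> k ∈ n.
Proof. by move=> [_ h _ _] /h [k' [x' [hk /pair_inj [-> _]]]]. Qed.

Lemma in_snoc_lt s n k x y : k ∈ n -> opair k y ∈ snoc s n x <-> opair k y ∈ s.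
Proof.
rewrite in_snoc => h; split; last by left.
by case=> // /pair_inj[e _]; rewrite e in h; case: (not_mem_self h).
Qed.

Lemma in_snoc_eq s n x y : is_seq s n -> opair n y ∈ snoc s n x <-> y = x.
Proof.
rewrite in_snoc => hs; split=> [|->]; last by right.
by case=> [/(seqn_dom hs)/not_mem_self|/pair_inj[]].
Qed.

Lemma seqn_empty : is_seq empty empty.
Proof. by split=> [|p /emptyP|? ? ? /emptyP|? /emptyP] //; exact: nat_zero. Qed.

Lemma seqn_snoc s n x : is_seq s n -> is_seq (snoc s n x) (succ n).
Proof.
move=> hs; have [hn h1 h2 h3] := hs; split=> [|p|k y z|k]; first exact: nat_succ.
- rewrite in_snoc => -[/h1 [k [y [hk ->]]]|->]; [exists k, y|exists n, x]; rewrite in_succ; tauto.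
- rewrite !in_snoc => -[a|/pair_inj[-> ->]] -[b|/pair_inj[e ?]] //; first exact: h2 a b.
    by move: (seqn_dom hs a); rewrite e => /not_mem_self.
  by move: (seqn_dom hs b) => /not_mem_self.
- rewrite in_succ => -[/h3 [y hy]|->]; [exists y|exists x]; rewrite in_snoc; tauto.
Qed.

Lemma seqn_inj s n m : is_seq s n -> is_seq s m -> n = m.
Proof.
move=> hn hm; apply: set_ext => k; have [_ _ _ h1] := hn; have [_ _ _ h2] := hm.
by split=> [/h1|/h2] [x hx]; apply: seqn_dom hx.
Qed.

Lemma dfn_is_seq (E CI UI : Type) (ci : CI -> E -> M -> Prop) (ui : UI -> E -> M) t1 t2 :
  tfn ci ui t1 -> tfn ci ui t2 -> dfn ci ui (fun e v => is_seq (t1 e v) (t2 e v)).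
Proof. by apply: (@dfn_sub2 _ _ _ _ _ _ (fun _ => is_seq)); rewrite /is_seq; dfn. Qed.

Lemma tfn_snoc (E CI UI : Type) (ci : CI -> E -> M -> Prop) (ui : UI -> E -> M) t1 t2 t3 :
  tfn ci ui t1 -> tfn ci ui t2 -> tfn ci ui t3 ->
  tfn ci ui (fun e v => snoc (t1 e v) (t2 e v) (t3 e v)).
Proof. by move=> *; rewrite /snoc; dfn. Qed.

End Naturals.

Ltac dfn_extra_seqn := match goal with
 | |- dfn _ _ (fun _ _ => is_seq _ _) => apply: dfn_is_seq
 | |- tfn _ _ (fun _ _ => snoc _ _ _) => apply: tfn_snoc
 end.
Ltac dfn_extra ::= first [dfn_extra_basic | dfn_extra_sets | dfn_extra_seqn].

(** * Iteration, foundation for classes, formulas *)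

Section Iteration.
Context {M : gbc}.
Implicit Types (x y z a b c k m n s p : M) (C H : cls M).

Section Iterate.
Variables (g : M -> M) (a : M).
Hypothesis hg : ptfn (fun v => g (v 0)).

Definition approx s n :=
  [/\ is_seq s (succ n), forall y, opair empty y ∈ s -> y = a
    & forall k y, k ∈ n -> opair k y ∈ s -> opair (succ k) (g y) ∈ s].

Lemma tfn_g t : ptfn t -> ptfn (fun v => g (t v)).
Proof. move=> ht; exact: (@tfn_fun1 _ _ _ _ _ _ (fun _ => g) _ hg ht). Qed.

(** Recursion along ω is available without [ETR]: its approximations are sets, so the solution is
    definable by quantifying over them. *)
Lemma iteration : exists H : cls M,
  [/\ forall p, H p -> exists n y, is_nat n /\ p = opair n y,
      forall n y z, H (opair n y) -> H (opair n z) -> y = z,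
      H (opair empty a)
    & forall n y, H (opair n y) -> H (opair (succ n) (g y))].
Proof.
have hgv t : ptfn t -> ptfn (fun v => g (t v)) by exact: tfn_g.
have da : pdef (fun v => approx (v 0) (v 1)).
  by rewrite /approx; dfn; apply: hgv; dfn.
have [H hH] : exists H : cls M, forall p, H p <->
    exists n y s, [/\ is_nat n, p = opair n y, approx s n & opair n y ∈ s].
  apply: comprehension; dfn.
  by apply: (@dfn_sub2 _ _ _ _ _ _ (fun _ => approx)); dfn.
have HE n y : H (opair n y) <-> is_nat n /\ exists s, approx s n /\ opair n y ∈ s.
  rewrite hH; split=> [[m [z [s [hm /pair_inj[-> ->] hs1 hs2]]]]|[hn [s [h1 h2]]]].
    by split=> //; exists s.
  by exists n, y, s.
have agree n m s s' : is_nat n -> is_nat m -> approx s n -> approx s' m -> forall k, is_nat k ->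
    (k ∈ succ n -> k ∈ succ m -> forall y z, opair k y ∈ s -> opair k z ∈ s' -> y = z).
  move=> hn hm [hs1 hs2 hs3] [ht1 ht2 ht3].
  have [_ _ hsf hst] := hs1; have [_ _ htf htt] := ht1.
  apply: nat_ind => [||k hk IH]; first by dfn.
    by move=> _ _ y z /hs2 -> /ht2 ->.
  move=> h1 h2 y z hy hz.
  have lt i : is_nat i -> succ k ∈ succ i -> k ∈ i.
    move=> hi; rewrite in_succ => -[h|<-]; last exact: mem_succ.
    exact: (nat_trans hi h (mem_succ k)).
  have [k1 k2] := (lt _ hn h1, lt _ hm h2).
  have [|u hu] := hst k; first by rewrite in_succ; left.
  have [|w hw] := htt k; first by rewrite in_succ; left.
  have e : u = w by apply: (IH _ _ u w hu hw); rewrite in_succ; left.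
  by rewrite (hsf _ _ _ hy (hs3 _ _ k1 hu)) (htf _ _ _ hz (ht3 _ _ k2 hw)) e.
exists H; split=> [p /hH [n [y [s [? ? _ _]]]]|n y z||]; first by exists n, y.
- rewrite !HE => -[hn [s [hs hy]]] [_ [t [ht hz]]].
  exact: (agree _ _ _ _ hn hn hs ht _ hn (mem_succ n) (mem_succ n) _ _ hy hz).
- rewrite HE; split; first exact: nat_zero.
  exists (snoc empty empty a); split; last by rewrite in_snoc; right.
  split; first exact/seqn_snoc/seqn_empty.
    by move=> y; rewrite in_snoc => -[/emptyP//|/pair_inj[]].
  by move=> k y /emptyP.
move=> n y; rewrite !HE => -[hn [s [[hs1 hs2 hs3] hy]]]; split; first exact: nat_succ.
exists (snoc s (succ n) (g y)); split; last by rewrite in_snoc; right.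
split; first exact: seqn_snoc.
  move=> z; rewrite in_snoc => -[/hs2//|/pair_inj[e _]].
  by case: (succ_neq0 (esym e)).
move=> k z; rewrite !in_snoc in_succ => hk [hz|/pair_inj[e _]]; last first.
  rewrite e in hk; case: hk => [hk|hk]; last by have := @mem_succ _ n; rewrite hk => /not_mem_self.
  by case: (not_mem_cycle hk (mem_succ n)).
case: hk => [hk|hk]; first by left; apply: hs3.
by right; rewrite hk in hz *; have [_ _ hf _] := hs1; rewrite (hf _ _ _ hz hy).
Qed.

End Iterate.

Lemma iteration_set (g : M -> M) a : ptfn (fun v => g (v 0)) ->
  exists U, a ∈ U /\ forall x, x ∈ U -> g x ∈ U.
Proof.
move=> hg; have [H [h1 h2 h3 h4]] := iteration a hg.
have [|U hU] := gb_replacement (modelP M) (F := H) _ om.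
  by move=> n y z; rewrite !holdsE; exact: h2.
exists U; split=> [|x].
  by rewrite hU; exists empty; [rewrite in_om; exact: nat_zero | rewrite holdsE].
rewrite !hU => -[n hn]; rewrite holdsE => hx.
by exists (succ n); [move: hn; rewrite !in_om; exact: nat_succ | rewrite holdsE; exact: h4].
Qed.

Definition transitive x := forall y, y ∈ x -> subset y x.

Lemma transitive_containment a : exists t, transitive t /\ subset a t.
Proof.
have [|U [h1 h2]] := @iteration_set bigU a; first by dfn.
exists (bigU U); split=> [y|x hx]; last by rewrite in_bigU; exists a.
rewrite in_bigU => -[x hx hy] z hz; rewrite in_bigU; exists (bigU x); first exact: h2.
by rewrite in_bigU; exists y.
Qed.

(** Foundation is an axiom about sets. A transitive [t] including [x] reduces to it: if [P] misses
    [t], then [x] itself is minimal; otherwise a minimal element of the part of [t] in [P] stays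
    minimal, because its elements are again in [t]. *)
Lemma class_foundation (P : M -> Prop) : pdef (fun v => P (v 0)) ->
  (exists x, P x) -> exists2 x, P x & forall y, y ∈ x -> ~ P y.
Proof.
move=> hP [x hx]; have [t [ht hs]] := transitive_containment x.
have h2 : pdef (fun v => P (v 0)) by [].
have [[y hy]|none] := classic (exists y, y ∈ sep t P); last first.
  by exists x => // y /hs hy hp; apply: none; exists y; rewrite in_sep.
have [|z] := gb_foundation (modelP M) (x := sep t P); first by exists y.
rewrite in_sep // => -[hz hpz] hmin; exists z => // u hu hpu.
by apply: (hmin u hu); rewrite in_sep //; split=> //; exact: ht hz _ hu.
Qed.

Definition ccode (k : nat) x := opair (num k) x.
Definition ccode2 (k : nat) x y := ccode k (opair x y).

Lemma tagged1E (k : nat) c x : tagged1 k c x <-> c = ccode k x.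
Proof.
split=> [[t /is_numeralE -> /is_pairE //]|->].
by exists (num k); [rewrite is_numeralE | rewrite is_pairE].
Qed.

Lemma tagged2E (k : nat) c x y : tagged2 k c x y <-> c = ccode2 k x y.
Proof.
split=> [[q /is_pairE -> /tagged1E //]|->].
by exists (opair x y); [rewrite is_pairE | rewrite tagged1E].
Qed.

Definition code_closed a :=
  [/\ forall i j, is_nat i -> is_nat j -> ccode2 0 i j ∈ a,
      forall i j, is_nat i -> is_nat j -> ccode2 1 i j ∈ a,
      forall i, is_nat i -> ccode 2 i ∈ a & forall i, is_nat i -> ccode 3 i ∈ a] /\
  [/\ forall f, f ∈ a -> ccode 4 f ∈ a,
      forall f g, f ∈ a -> g ∈ a -> ccode2 5 f g ∈ a
    & forall n f, is_nat n -> f ∈ a -> ccode2 6 n f ∈ a].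

Lemma formula_closedE a : formula_closed a <-> code_closed a.
Proof.
split=> [[h0 h1 h2 h3 h4 h5 h6]|[[h0 h1 h2 h3] [h4 h5 h6]]].
  split; split.
  - by move=> i j hi hj; apply: h0 hi hj _; apply/tagged2E.
  - by move=> i j hi hj; apply: h1 hi hj _; apply/tagged2E.
  - by move=> i hi; apply: h2 hi _; apply/tagged1E.
  - by move=> i hi; apply: h3 hi _; apply/tagged1E.
  - by move=> f hf; apply: h4 hf _; apply/tagged1E.
  - by move=> f g hf hg; apply: h5 hf hg _; apply/tagged2E.
  - by move=> n f hn hf; apply: h6 hn hf _; apply/tagged2E.
split.
- by move=> c i j hi hj /tagged2E ->; exact: h0.
- by move=> c i j hi hj /tagged2E ->; exact: h1.
- by move=> c i hi /tagged1E ->; exact: h2.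
- by move=> c i hi /tagged1E ->; exact: h3.
- by move=> c f hf /tagged1E ->; exact: h4.
- by move=> c f g hf hg /tagged2E ->; exact: h5.
- by move=> c n f hn hf /tagged2E ->; exact: h6.
Qed.

(** [K] is the union of ω, P(ω), P(P(ω)), and so on. As ω is transitive, these sets increase; two
    elements thus lie in a common one, and their pair is in the next. *)
Lemma ex_pairing_closed : exists K : M, (forall n, is_nat n -> n ∈ K) /\
  forall x y, x ∈ K -> y ∈ K -> upair x y ∈ K.
Proof.
have hp : ptfn (fun v => pow (v 0 : M)) by dfn.
have [H [h1 h2 h3 h4]] := iteration om hp.
have tot : forall n, is_nat n -> exists y, H (opair n y).
  apply: nat_ind => [||n hn [y hy]]; first by dfn.
    by exists om.
  by exists (pow y); apply: h4.
have tr : forall n, is_nat n -> forall y, H (opair n y) -> transitive y.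
  rewrite /transitive; apply: nat_ind => [|y|n hn IH y]; first by dfn.
    move/(h2 _ _ _ h3) => <- m; rewrite in_om => hm k; rewrite in_om; exact: nat_mem.
  have [z hz] := tot n hn; move/(h2 _ _ _ (h4 _ _ hz)) => <- u; rewrite in_pow => hu w /hu hw.
  by rewrite in_pow; exact: IH hw.
have mono m y : H (opair m y) -> forall n, is_nat n -> (m ∈ n \/ m = n) -> forall z, H (opair n z) -> subset y z.
  move=> hy; apply: nat_ind => [||n hn IH].
  - by dfn.
  - by case=> [/emptyP//|e] z; rewrite -e => /(h2 _ _ _ hy) ->.
  case=> [hm|e] z; last by rewrite -e => /(h2 _ _ _ hy) ->.
  rewrite in_succ in hm; have [w hw] := tot n hn.
  move/(h2 _ _ _ (h4 _ _ hw)) => <- u /(IH hm _ hw) hu; rewrite in_pow.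
  exact: tr hw _ hu.
have [|U hU] := gb_replacement (modelP M) (F := H) _ om.
  by move=> n y z; rewrite !holdsE; exact: h2.
have KE x : x ∈ bigU U <-> exists n y, [/\ is_nat n, H (opair n y) & x ∈ y].
  rewrite in_bigU; split=> [[y]|[n [y [hn hy hx]]]].
    by rewrite hU => -[n]; rewrite in_om holdsE; exists n, y.
  by exists y => //; rewrite hU; exists n; rewrite ?in_om ?holdsE.
exists (bigU U); split=> [n hn|x y].
  by rewrite KE; exists empty, om; rewrite in_om; split=> //; exact: nat_zero.
rewrite !KE => -[n [u [hn hu hx]]] [m [w [hm hw hy]]].
have [k [z [hk hz hx' hy']]] : exists k z, [/\ is_nat k, H (opair k z), x ∈ z & y ∈ z].
  have [h|h|h] := nat_total hn hm.
  - by exists m, w; split=> //; apply: (mono _ _ hu _ hm _ _ hw) => //; left.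
  - by exists m, w; split=> //; apply: (mono _ _ hu _ hm _ _ hw) => //; right.
  - by exists n, u; split=> //; apply: (mono _ _ hw _ hn _ _ hu) => //; left.
exists (succ k), (pow z); split; [exact: nat_succ | exact: h4 |].
by rewrite in_pow => v; rewrite in_upair => -[->|->].
Qed.

(** [is_formula] is an intersection over all closed sets and would hold of everything if there were
    none. One closed set also bounds the formulas, which therefore form a set. *)
Lemma ex_formula_closed : exists a : M, formula_closed a.
Proof.
have [K [h1 h2]] := ex_pairing_closed; exists K.
have hpair x y : x ∈ K -> y ∈ K -> opair x y ∈ K by move=> hx hy; apply: (h2); apply: h2.
have hnum (k : nat) : num k ∈ K by apply/h1/num_nat.
by rewrite formula_closedE; split; split=> *; do ?[assumption | exact: hnum | exact: h1 | apply: (hpair)].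
Qed.

Lemma ex_formula_set : exists A : M, forall f, f ∈ A <-> is_formula f.
Proof.
have [K hK] := ex_formula_closed; exists (sep K (@is_formula M)) => f.
rewrite in_sep; first by split=> [[]//|h]; split=> //; exact: h.
apply: (dfn_iff (P := fun _ v => forall a, code_closed a -> v 0 ∈ a)).
  by move=> _ v; split=> h a /formula_closedE; exact: h.
by rewrite /code_closed /ccode2 /ccode; dfn.
Qed.

Definition subformula (g f : M) :=
  [\/ f = ccode 4 g, exists h, f = ccode2 5 g h, exists h, f = ccode2 5 h g
    | exists n, f = ccode2 6 n g].

Lemma ccode_inj (j k : nat) x y : ccode j x = ccode k y -> j = k /\ x = y.
Proof. by move/pair_inj=> [/num_inj]. Qed.

Lemma subformulaE (g : M) (k : nat) x : subformula g (ccode k x) ->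
  match k with
  | 4 => g = x
  | 5 => exists h, x = opair g h \/ x = opair h g
  | 6 => exists n, x = opair n g
  | _ => False
  end.
Proof.
rewrite /subformula /ccode2.
case=> [/ccode_inj [-> ->]|[h /ccode_inj [-> ->]]|[h /ccode_inj [-> ->]]|[n /ccode_inj [-> ->]]] //.
- by exists h; left.
- by exists h; right.
- by exists n.
Qed.

Lemma formula_set_closed (A : M) : (forall f, f ∈ A <-> is_formula f) -> formula_closed A.
Proof.
by move=> hA; split=> [c i j hi hj hc|c i j hi hj hc|c i hi hc|c i hi hc
    |c f /hA hf hc|c f g /hA hf /hA hg hc|c n f hn /hA hf hc];
  apply/hA => a ha; [apply: fc_mem hc|apply: fc_eq hc|apply: fc_Z hc|apply: fc_W hc
    |apply: fc_neg hc|apply: fc_and hc|apply: fc_ex hc] => //; auto.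
Qed.

(** Structural induction for codes that may be nonstandard. If no minimal formula in [P] existed,
    the formulas outside [P] would be closed under all constructors, hence would be all formulas. *)
Lemma subformula_wf (P : M -> Prop) : pdef (fun v => P (v 0)) ->
  (exists f, is_formula f /\ P f) ->
  exists f, [/\ is_formula f, P f & forall g, subformula g f -> ~ P g].
Proof.
move=> hP [f [hf hPf]]; apply: NNPP => none.
have [A hA] := ex_formula_set.
have hN : pdef (fun v => ~ P (v 0)) by dfn.
have /formula_closedE [[c0 c1 c2 c3] [c4 c5 c6]] := formula_set_closed hA.
suff: f ∈ sep A (fun g => ~ P g) by rewrite in_sep // => -[_ []].
have step g : g ∈ A -> (forall h, subformula h g -> ~ P h) -> g ∈ sep A (fun g => ~ P g).
  by rewrite hA => hg h; rewrite in_sep // hA; split=> // hPg; apply: none; exists g.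
apply: hf; rewrite formula_closedE.
split; split.
- by move=> i j hi hj; apply: step => [|h /subformulaE//]; exact: c0.
- by move=> i j hi hj; apply: step => [|h /subformulaE//]; exact: c1.
- by move=> i hi; apply: step => [|h /subformulaE//]; exact: c2.
- by move=> i hi; apply: step => [|h /subformulaE//]; exact: c3.
- move=> g; rewrite in_sep // => -[hg hn]; apply: step => [|h]; first exact: c4.
  by move=> /subformulaE ->.
- move=> g g' /(in_sep _ _ hN) [hg hn] /(in_sep _ _ hN) [hg' hn']; apply: step => [|h]; first exact: c5.
  by move=> /subformulaE [k [] /pair_inj [e e']]; rewrite -?e -?e'.
- move=> n g hn; rewrite in_sep // => -[hg hng]; apply: step => [|h]; first exact: c6.
  by move=> /subformulaE [k /pair_inj [_ <-]].
Qed.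

End Iteration.

(** * A well-order of the universe *)

Section Levels.
Context {M : gbc}.
Implicit Types (x y z a b c h r s : M).

(** The levels [V_α] without ordinals (Montague, Scott, Button): a history lists
    the levels below some level [s], each being the union of the powersets of the
    earlier ones. *)
Definition history h :=
  forall x, x ∈ h -> forall z, z ∈ x <-> exists c, [/\ c ∈ h, c ∈ x & subset z c].

Definition level s :=
  exists h, history h /\ forall z, z ∈ s <-> exists2 c, c ∈ h & subset z c.

Lemma history_subset h x y z : history h -> x ∈ h -> y ∈ x -> subset z y -> z ∈ x.
Proof.
move=> hh hx /(hh x hx) [c [hc hcx hyc]] hzy; apply/(hh x hx).
by exists c; split=> // u /hzy /hyc.
Qed.

Lemma history_trans h x : history h -> x ∈ h -> transitive x.
Proof.
move=> hh hx; apply: NNPP => hnt.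
have dP : pdef (fun v => ~ transitive (v 0 : M)) by rewrite /transitive; dfn.
have [|y] := gb_foundation (modelP M) (x := sep h (fun x => ~ transitive x)).
  by exists x; rewrite in_sep.
rewrite in_sep // => -[hy hny] hmin; apply: hny => z hz u hu.
have [d [hd hdy hzd]] := iffLR (hh y hy z) hz.
have td : transitive d by apply: NNPP => hn; apply: (hmin d hdy); rewrite in_sep.
by apply: (history_subset hh hy hdy); exact: td (hzd _ hu).
Qed.

Lemma level_subset s x z : level s -> x ∈ s -> subset z x -> z ∈ s.
Proof.
move=> [h [hh hs]] /hs [c hc hxc] hz; apply/hs.
by exists c => // u /hz /hxc.
Qed.

Lemma level_trans s : level s -> transitive s.
Proof.
move=> [h [hh hs]] x /hs [c hc hxc] z /hxc hz; apply/hs.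
by exists c => //; exact: (history_trans hh hc) hz.
Qed.

Lemma history_level h c : history h -> c ∈ h -> level c.
Proof.
move=> hh hc; have hE z : z ∈ sep h (fun x => x ∈ c) <-> z ∈ h /\ z ∈ c.
  by rewrite in_sep //; dfn.
exists (sep h (fun x => x ∈ c)); split=> [x|z].
  rewrite hE => -[hx hxc] z; rewrite (hh x hx); split=> -[d []].
    move=> hd hdx hzd; exists d; rewrite hE; split=> //; split=> //.
    exact: (history_trans hh hc hxc).
  by rewrite hE => -[hd _] hdx hzd; exists d.
rewrite (hh c hc); split=> [[d [h1 h2 h3]]|[d]]; first by exists d; rewrite ?hE.
by rewrite hE => -[h1 h2] h3; exists d.
Qed.

(** Levels are described here by lower levels alone; with the histories gone, two levels can be
    compared. *)
Lemma in_level s z : level s -> z ∈ s <-> exists r, [/\ r ∈ s, level r & subset z r].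
Proof.
move=> hs; split=> [|[r [hr _ hz]]]; last exact: level_subset hz.
have [h [hh hE]] := hs; move=> /hE [c hc hzc]; exists c; split=> //.
  by apply/hE; exists c.
exact: history_level hc.
Qed.

Lemma dfn_level (E CI UI : Type) (ci : CI -> E -> M -> Prop) (ui : UI -> E -> M) t1 :
  tfn ci ui t1 -> dfn ci ui (fun e v => level (t1 e v)).
Proof. by apply: (@dfn_sub1 _ _ _ _ _ _ (fun _ => level)); rewrite /level /history; dfn. Qed.

Lemma level_wf (P : M -> Prop) : pdef (fun v => P (v 0)) -> (exists s, level s /\ P s) ->
  exists s, [/\ level s, P s & forall t, t ∈ s -> level t -> ~ P t].
Proof.
move=> hP hex; have [|s [h1 h2] h3] := class_foundation (P := fun s => level s /\ P s) _ hex.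
  by dfn; apply: dfn_level; dfn.
by exists s; split=> // t ht hl hPt; apply: (h3 t ht).
Qed.

(** Double minimality: take [a] least among the levels incomparable with some level, then [c] least
    among those incomparable with [a]. Everything below either one is comparable with the other,
    which forces a = c. *)
Lemma level_total s (t : M) : level s -> level t -> [\/ s ∈ t, s = t | t ∈ s].
Proof.
move=> hs ht; apply: NNPP => hst.
have dl t1 : ptfn t1 -> pdef (fun v => level (t1 v)) by exact: dfn_level.
have [||a [la [b [lb hab]] mina]] :=
  @level_wf (fun a => exists b, level b /\ ~ [\/ a ∈ b, a = b | b ∈ a]).
- by dfn; apply: dl; dfn.
- by exists s; split=> //; exists t.
have [||c [lc hac minc]] := @level_wf (fun b => ~ [\/ a ∈ b, a = b | b ∈ a]).
- by dfn.
- by exists b.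
apply: (hac); constructor 2; apply: set_ext => z; split.
  move/(in_level _ la) => [r [hr lr hz]].
  have : [\/ r ∈ c, r = c | c ∈ r] by apply: NNPP => hn; apply: (mina r hr lr); exists c.
  case=> [h|h|h]; first exact: level_subset h hz.
    by case: hac; constructor 3; rewrite -h.
  by case: hac; constructor 3; exact: level_trans la _ hr _ h.
move/(in_level _ lc) => [r [hr lr hz]].
have : [\/ a ∈ r, a = r | r ∈ a] by apply: NNPP => hn; exact: (minc r hr lr).
case=> [h|h|h]; last exact: level_subset h hz.
  by case: hac; constructor 1; exact: level_trans lc _ hr _ h.
by case: hac; constructor 1; rewrite h.
Qed.

Definition least_level (a s : M) :=
  [/\ level s, subset a s & forall r, r ∈ s -> level r -> ~ subset a r].

Lemma least_level_uniq a s (t : M) : least_level a s -> least_level a t -> s = t.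
Proof.
move=> [ls has hs] [lt hat ht]; have [h|//|h] := level_total ls lt.
  by case: (ht s h ls).
by case: (hs t h lt).
Qed.

Lemma dfn_least_level (E CI UI : Type) (ci : CI -> E -> M -> Prop) (ui : UI -> E -> M) t1 t2 :
  tfn ci ui t1 -> tfn ci ui t2 -> dfn ci ui (fun e v => least_level (t1 e v) (t2 e v)).
Proof.
by apply: (@dfn_sub2 _ _ _ _ _ _ (fun _ => least_level)); rewrite /least_level; dfn; apply: dfn_level; dfn.
Qed.

(** This says that the levels exhaust the universe. At an ∈-minimal failure [b], replacement
    collects the least levels of the elements of [b], and the level built from them includes [b]. *)
Lemma ex_least_level a : exists s, least_level a s.
Proof.
have least b s : level s -> subset b s -> exists t, least_level b t.
  move=> hs hbs; have [||t [h1 h2 h3]] := @level_wf (fun t => subset b t); first by dfn.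
    by exists s.
  by exists t; split.
apply: NNPP => hna.
have [||b hb hmin] := @class_foundation _ (fun a => ~ exists s, least_level a s); [|by exists a|].
  by dfn; apply: dfn_least_level; dfn.
apply: hb; have [F hF] : exists F : cls M, forall p, F p <-> exists x s, p = opair x s /\ least_level x s.
  by apply: comprehension; dfn; apply: dfn_least_level; dfn.
have FE x s : F (opair x s) <-> least_level x s.
  by rewrite hF; split=> [[y [t [/pair_inj[-> ->]]]]|]; last by exists x, s.
have [|K hK] := gb_replacement (modelP M) (F := F) _ b.
  by move=> x s t; rewrite !holdsE !FE; exact: least_level_uniq.
have lK k : k ∈ K -> level k by rewrite hK => -[x _]; rewrite holdsE FE => -[].
(* Adding all levels below those in [K] makes the collection a history. *)
pose h := sep (union2 K (bigU K)) level.
have hE r : r ∈ h <-> level r /\ (r ∈ K \/ exists2 k, k ∈ K & r ∈ k).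
  by rewrite in_sep ?in_union2 ?in_bigU; [tauto | apply: dfn_level; dfn].
have hdown r x : level r -> x ∈ h -> r ∈ x -> r ∈ h.
  move=> lr; rewrite !hE => -[lx [hx|[k hk hx]]] hr; split=> //; right.
    by exists x.
  by exists k => //; exact: (level_trans (lK k hk) hx).
have hh : history h.
  move=> x hx z; have lx : level x by move: hx; rewrite hE => -[].
  rewrite (in_level _ lx); split=> [[r [h1 h2 h3]]|[c [h1 h2 h3]]].
    by exists r; split=> //; exact: hdown h1.
  by exists c; split=> //; move: h1; rewrite hE => -[].
pose S := sep (pow (bigU h)) (fun z => exists2 c, c ∈ h & subset z c).
have SE z : z ∈ S <-> exists2 c, c ∈ h & subset z c.
  rewrite in_sep; last by dfn.
  split=> [[]//|hz]; split=> //; rewrite in_pow; have [c hc hzc] := hz.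
  by move=> u /hzc hu; rewrite in_bigU; exists c.
apply: (least b S); first by exists h.
move=> x hx; have [s hs] : exists s, least_level x s by apply: NNPP => hn; exact: hmin hn.
apply/SE; exists s; last by case: hs.
rewrite hE; split; [by case: hs | left].
by rewrite hK; exists x => //; rewrite holdsE FE.
Qed.

Definition lv a := eps (least_level a).

Lemma lvP a : least_level a (lv a).
Proof. exact: epsP (ex_least_level a). Qed.

Lemma tfn_lv (E CI UI : Type) (ci : CI -> E -> M -> Prop) (ui : UI -> E -> M) t1 :
  tfn ci ui t1 -> tfn ci ui (fun e v => lv (t1 e v)).
Proof.
apply: (@tfn_fun1 _ _ _ _ _ _ (fun _ => lv)).
apply: (dfn_iff (P := fun e v => least_level (v 1) (v 0))); last by apply: dfn_least_level; dfn.
by move=> e v; split=> [h|->]; [exact: least_level_uniq h (lvP _) | exact: lvP].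
Qed.

End Levels.

Ltac dfn_extra_level := match goal with
 | |- dfn _ _ (fun _ _ => level _) => apply: dfn_level
 | |- tfn _ _ (fun _ _ => lv _) => apply: tfn_lv
 end.
Ltac dfn_extra ::= first [dfn_extra_basic | dfn_extra_sets | dfn_extra_seqn | dfn_extra_level].

(** * Zermelo's well-ordering of a set from a choice class *)

Section Zermelo.
Context {M : gbc}.
Variable F : cls M.
Hypothesis F_fun : functional F.
Hypothesis F_choice : forall x : M, (exists y, y ∈ x) -> exists2 y, y ∈ x & holds F x y.
Implicit Types (x y z A B D X Y Z : M).

Definition remove X := sep X (fun y => ~ F (opair X y)).

Lemma in_remove y X : y ∈ remove X <-> y ∈ X /\ ~ F (opair X y).
Proof. by rewrite in_sep //; dfn. Qed.

Lemma remove_subset X : subset (remove X) X.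
Proof. by move=> y; rewrite in_remove => -[]. Qed.

Lemma F_uniq X y z : F (opair X y) -> F (opair X z) -> y = z.
Proof. by rewrite -!holdsE; exact: F_fun. Qed.

Lemma tfn_remove t : ptfn t -> ptfn (fun v => remove (t v)).
Proof.
apply: (@tfn_fun1 _ _ _ _ _ _ (fun _ => remove)).
apply: (dfn_iff (P := fun _ v => forall y, y ∈ v 0 <-> y ∈ v 1 /\ ~ F (opair (v 1) y))); last by dfn.
by move=> _ v; split=> [h|-> y]; [apply: set_ext => y; rewrite h in_remove | rewrite in_remove].
Qed.

Definition is_bigI Y A := forall y, y ∈ Y <-> forall X, X ∈ A -> y ∈ X.

(** These are Zermelo's Θ-chains. *)
Definition closed_chain B T :=
  [/\ B ∈ T, forall X, X ∈ T -> remove X ∈ T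
    & forall A Y, (exists X, X ∈ A) -> subset A T -> is_bigI Y A -> Y ∈ T].

(** Zermelo (1908): what is left of [B] after removing the chosen elements one
    by one, transfinitely. *)
Definition remainder B X := subset X B /\ forall T, closed_chain B T -> X ∈ T.

Lemma dfn_remainder t1 t2 : ptfn t1 -> ptfn t2 -> pdef (fun v => remainder (t1 v) (t2 v)).
Proof.
apply: (@dfn_sub2 _ _ _ _ _ _ (fun _ => remainder)).
by rewrite /remainder /closed_chain /is_bigI; dfn; apply: tfn_remove; dfn.
Qed.

Lemma bigI_subset Y A X : is_bigI Y A -> X ∈ A -> subset Y X.
Proof. by move=> h hX y /h; apply. Qed.

Section Chain.
Variable B : M.

Lemma remainder_top : remainder B B.
Proof. by split=> // T []. Qed.

Lemma remainder_remove X : remainder B X -> remainder B (remove X).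
Proof.
move=> [h1 h2]; split=> [y /remove_subset/h1 //|T hT].
by have [_ h3 _] := hT; apply: h3; exact: h2.
Qed.

Lemma remainder_bigI A Y : (exists X, X ∈ A) -> (forall X, X ∈ A -> remainder B X) ->
  is_bigI Y A -> remainder B Y.
Proof.
move=> hA h hY; split=> [y hy|T hT].
  by have [X hX] := hA; have [hs _] := h X hX; exact: hs _ (bigI_subset hY hX hy).
by have [_ _ h3] := hT; apply: (h3 A) => // X /h [_]; apply.
Qed.

(** The remainders satisfying [P] form a closed chain, and every remainder belongs to every closed
    chain. *)
Lemma remainder_ind (P : M -> Prop) : pdef (fun v => P (v 0)) -> P B ->
  (forall X, remainder B X -> P X -> P (remove X)) ->
  (forall A Y, (exists X, X ∈ A) -> (forall X, X ∈ A -> remainder B X /\ P X) ->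
     is_bigI Y A -> P Y) ->
  forall X, remainder B X -> P X.
Proof.
move=> hP h1 h2 h3 X [hX1 hX2].
have TE Y : Y ∈ sep (pow B) (fun Y => remainder B Y /\ P Y) <-> remainder B Y /\ P Y.
  rewrite in_sep; last by dfn; apply: dfn_remainder; dfn.
  by rewrite in_pow; split=> [[]//|h]; split=> //; case: h => -[].
suff: X ∈ sep (pow B) (fun Y => remainder B Y /\ P Y) by rewrite TE => -[].
apply: hX2; split=> [|Y|A Y hA hs hY].
- by rewrite TE; split=> //; exact: remainder_top.
- by rewrite !TE => -[hY hPY]; split; [exact: remainder_remove | exact: h2].
- rewrite TE; have hs' Z : Z ∈ A -> remainder B Z /\ P Z by move/hs; rewrite TE.
  by split; [apply: remainder_bigI hY => // Z /hs' [] | apply: h3 hY].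
Qed.

(** Induction on [Y] and, at a removal step, on [X], with the sharper alternative X ⊆ remove Y or Y
    ⊆ X: no remainder lies strictly between [remove Y] and [Y]. *)
Lemma remainder_linear Y : remainder B Y ->
  forall X, remainder B X -> subset X Y \/ subset Y X.
Proof.
have dr := dfn_remainder.
move: Y; apply: remainder_ind => [|X [hX _]|Y hY IH X hX|A Y hA IH hY X hX].
- by dfn; apply: dr; dfn.
- by left.
- suff: subset X (remove Y) \/ subset Y X.
    by case=> h; [left | right => y /remove_subset/h].
  move: X hX; apply: remainder_ind => [|||A Z hA IH' hZ].
  + by dfn; apply: tfn_remove; dfn.
  + by right; case: hY.
  + move=> X hX [h|h]; first by left=> x /remove_subset/h.
    case: (IH _ (remainder_remove hX)) => h'; last by right.
    case: (classic (subset Y (remove X))) => hn; first by right.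
    have [y hy] : exists y, ~ (y ∈ Y -> y ∈ remove X) by apply/not_all_ex_not.
    have [hyY hyR] : y ∈ Y /\ ~ y ∈ remove X by apply: imply_to_and.
    have hFy : F (opair X y) by apply: NNPP => hF; apply: hyR; rewrite in_remove; split=> //; exact: h.
    (* Here remove X ⊆ Y ⊆ X, and [Y] contains the only element that is removed from [X]. *)
    have -> : X = Y; last by left.
    apply: set_ext => z; split; last exact: h.
    move=> hz; case: (classic (F (opair X z))) => hFz; first by rewrite (F_uniq hFz hFy).
    by apply: h'; rewrite in_remove.
  + case: (classic (exists2 X, X ∈ A & subset X (remove Y))) => [[X hX hs]|hn].
      by left=> z /(bigI_subset hZ hX)/hs.
    right=> y hy; apply/hZ => X hX; case: (IH' X hX) => _ [h|h]; last exact: h.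
    by case: hn; exists X.
- case: (classic (exists2 Z, Z ∈ A & subset Z X)) => [[Z hZ hs]|hn].
    by right=> z /(bigI_subset hY hZ)/hs.
  left=> x hx; apply/hY => Z hZ; case: (IH Z hZ) => _ /(_ X hX) [h|h]; first exact: h.
  by case: hn; exists Z.
Qed.

(** The order of removal: at some stage [x] is gone while [y] is still present. *)
Definition zless x y := exists X, [/\ remainder B X, y ∈ X & ~ x ∈ X].

(** Used with [x ∈ X] and with [subset D X], it gives the smallest remainder that still contains
    [x], or still includes [D]. Removing its chosen element must destroy that property. *)
Lemma remainder_inter (P : M -> Prop) : pdef (fun v => P (v 0)) -> P B ->
  exists Z, remainder B Z /\ forall z, z ∈ Z <-> forall X, remainder B X -> P X -> z ∈ X.
Proof.
move=> hP hB; have dr := dfn_remainder.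
have AE X : X ∈ sep (pow B) (fun X => remainder B X /\ P X) <-> remainder B X /\ P X.
  rewrite in_sep; last by dfn; apply: dr; dfn.
  by rewrite in_pow; split=> [[]//|h]; split=> //; case: h => -[].
have ZE z : z ∈ sep B (fun z => forall X, remainder B X -> P X -> z ∈ X) <->
    forall X, remainder B X -> P X -> z ∈ X.
  rewrite in_sep; last first.
    by dfn; apply: dr; dfn.
  by split=> [[]//|h]; split=> //; apply: h => //; exact: remainder_top.
exists (sep B (fun z => forall X, remainder B X -> P X -> z ∈ X)); split=> //.
apply: (@remainder_bigI (sep (pow B) (fun X => remainder B X /\ P X))).
- by exists B; rewrite AE; split=> //; exact: remainder_top.
- by move=> X; rewrite AE => -[].
- move=> z; rewrite ZE; split=> [h X|h X h1 h2]; first by rewrite AE => -[]; exact: h.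
  by apply: h; rewrite AE.
Qed.

(** If no remainder separates [x] from [y], both equal the chosen element of the smallest remainder
    containing [x]: otherwise removing that element would leave a smaller one. *)
Lemma zless_total x y : x ∈ B -> y ∈ B -> [\/ zless x y, x = y | zless y x].
Proof.
move=> hx hy; apply: NNPP => hn.
have h1 X : remainder B X -> (x ∈ X <-> y ∈ X).
  move=> hX; split=> h; apply: NNPP => h'; apply: hn; [constructor 3|constructor 1]; by exists X.
have [|//|Z [hZ ZE]] := @remainder_inter (fun X => x ∈ X); first by dfn.
have hxZ : x ∈ Z by apply/ZE.
have [|c hcZ /holdsE hc] := F_choice (x := Z); first by exists x.
have key u : u ∈ Z -> (forall X, remainder B X -> (x ∈ X <-> u ∈ X)) -> u = c.
  move=> hu he; apply: NNPP => hne.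
  have hur : u ∈ remove Z.
    by rewrite in_remove; split=> // hF; apply: hne; exact: F_uniq hF hc.
  have hR := remainder_remove hZ.
  have : c ∈ remove Z by apply/(iffLR (ZE c) hcZ _ hR)/he.
  by rewrite in_remove => -[].
apply: hn; constructor 2; rewrite (key x) // (key y) //.
exact/(h1 Z hZ).
Qed.

(** The least element is the one chosen from the smallest remainder including [D]. It lies in [D] by
    minimality, and any remainder that still contains it includes [D] by linearity. *)
Lemma zless_least D : (exists x, x ∈ D) -> subset D B ->
  exists2 m, m ∈ D & forall y, y ∈ D -> ~ zless y m.
Proof.
move=> [x hx] hD.
have [|//|Z [hZ ZE]] := @remainder_inter (fun X => subset D X); first by dfn.
have hDZ : subset D Z by move=> y hy; apply/ZE => X _; apply.
have [|c hcZ /holdsE hc] := F_choice (x := Z); first by exists x; exact: hDZ.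
have hR := remainder_remove hZ.
exists c.
  apply: NNPP => hn.
  have : c ∈ remove Z.
    apply/(iffLR (ZE c) hcZ _ hR) => y hy; rewrite in_remove; split; first exact: hDZ.
    by move=> hF; apply: hn; rewrite (F_uniq hc hF).
  by rewrite in_remove => -[].
move=> y hy [X [hX hcX hyX]]; case: (remainder_linear hR hX) => h.
  by have := h c hcX; rewrite in_remove => -[].
apply: hyX; have hyZ := hDZ y hy.
case: (classic (F (opair Z y))) => hF; first by rewrite (F_uniq hF hc).
by apply: h; rewrite in_remove.
Qed.

End Chain.

Lemma dfn_zless t1 t2 t3 : ptfn t1 -> ptfn t2 -> ptfn t3 ->
  pdef (fun v => zless (t1 v) (t2 v) (t3 v)).
Proof.
apply: (@dfn_sub3 _ _ _ _ _ _ (fun _ => zless)).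
by rewrite /zless; dfn; apply: dfn_remainder; dfn.
Qed.

End Zermelo.

(** Totality together with least elements of definable collections is the form in which the
    Kleene-Brouwer order consumes the well-order. *)
Lemma global_well_order (M : gbc) : exists L : cls M,
  (forall x y, [\/ L (opair x y), x = y | L (opair y x)]) /\
  (forall P : M -> Prop, pdef (fun v => P (v 0)) -> (exists x, P x) ->
    exists2 x, P x & forall y, P y -> ~ L (opair y x)).
Proof.
have [F F_fun F_choice] := gb_global_choice (modelP M).
have [L hL] : exists L : cls M, forall p, L p <-> exists x y, p = opair x y /\
    (lv x ∈ lv y \/ lv x = lv y /\ zless F (pow (lv x)) x y).
  by apply: comprehension; dfn; apply: dfn_zless; dfn.
have LE x y : L (opair x y) <-> lv x ∈ lv y \/ lv x = lv y /\ zless F (pow (lv x)) x y.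
  by rewrite hL; split=> [[x' [y' [/pair_inj[-> ->]]]]|]; last by exists x, y.
exists L; split=> [x y|P hP [x hx]].
  have [lx hx _] := lvP x; have [ly hy _] := lvP y.
  have [h|h|h] := level_total lx ly.
  - by constructor 1; rewrite LE; left.
  - have [||?|?|?] := zless_total F_fun F_choice (B := pow (lv x)) (x := x) (y := y).
    + by rewrite in_pow.
    + by rewrite in_pow h.
    + by constructor 1; rewrite LE; right.
    + by constructor 2.
    + by constructor 3; rewrite LE; right; rewrite -h.
  - by constructor 3; rewrite LE; left.
have dP t : ptfn t -> pdef (fun v => P (t v)) by exact: (@dfn_sub1 _ _ _ _ _ _ (fun _ => P) _ hP).
(* The members of [P] of least level form a set, to which Zermelo's order applies. *)
have [||s [ls [z hz zs]] smin] := @level_wf M (fun s => exists2 x, P x & lv x = s).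
- by dfn; apply: dP; dfn.
- by exists (lv x); split; [case: (lvP x) | exists x].
have DE u : u ∈ sep (pow s) (fun u => P u /\ lv u = s) <-> P u /\ lv u = s.
  rewrite in_sep; last by dfn.
  split=> [[]//|h]; split=> //; rewrite in_pow; case: h => _ <-; by case: (lvP u).
have [||m] := zless_least F_fun F_choice (B := pow s) (D := sep (pow s) (fun u => P u /\ lv u = s)).
- by exists z; rewrite DE.
- by move=> u; rewrite in_sep => [[]|]//; dfn.
rewrite DE => -[hm ms] hmin; exists m => // y hy; rewrite LE ms => -[h|[h1 h2]].
  by apply: (smin _ h); [case: (lvP y) | exists y].
by apply: (hmin y); [rewrite DE | rewrite -h1].
Qed.

(** * The Kleene-Brouwer order *)

Section KleeneBrouwer.
Context {M : gbc}.
Variables I R L : cls M.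
Hypothesis R_on : relation_on I R.
Hypothesis R_wf : class_well_founded I R.
Hypothesis L_total : forall x y, [\/ L (opair x y), x = y | L (opair y x)].
Hypothesis L_least : forall P : M -> Prop, pdef (fun v => P (v 0)) -> (exists x, P x) ->
  exists2 x, P x & forall y, P y -> ~ L (opair y x).
Implicit Types (x y z b c d k m n p s : M).

(** The length is a successor so that every node has a last entry, the point of [I] at which the
    recursion is evaluated. *)
Definition node s := exists n,
  [/\ is_seq s (succ n), forall k x, opair k x ∈ s -> I x
    & forall k x y, opair k x ∈ s -> opair (succ k) y ∈ s -> R (opair y x)].

Definition is_last s x := exists n, is_seq s (succ n) /\ opair n x ∈ s.

Definition extends t s d := exists n, is_seq s (succ n) /\ t = snoc s (succ n) d.

Definition agree_below k s t := forall j, j ∈ k -> forall x, opair j x ∈ s <-> opair j x ∈ t.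

(** A missing entry counts as [+∞], so an extension of [t] precedes [t]. *)
Definition kb s t := exists k, [/\ is_nat k, agree_below k s t
  & (exists x, opair k x ∈ s) /\ ~ (exists y, opair k y ∈ t) \/
    exists x y, [/\ opair k x ∈ s, opair k y ∈ t & L (opair x y)]].

Lemma dfn_node t1 : ptfn t1 -> pdef (fun v => node (t1 v)).
Proof. by apply: (@dfn_sub1 _ _ _ _ _ _ (fun _ => node)); rewrite /node; dfn. Qed.

Lemma dfn_is_last (E CI UI : Type) (ci : CI -> E -> M -> Prop) (ui : UI -> E -> M) t1 t2 :
  tfn ci ui t1 -> tfn ci ui t2 -> dfn ci ui (fun e v => is_last (t1 e v) (t2 e v)).
Proof. by apply: (@dfn_sub2 _ _ _ _ _ _ (fun _ => is_last)); rewrite /is_last; dfn. Qed.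

Lemma dfn_extends (E CI UI : Type) (ci : CI -> E -> M -> Prop) (ui : UI -> E -> M) t1 t2 t3 :
  tfn ci ui t1 -> tfn ci ui t2 -> tfn ci ui t3 ->
  dfn ci ui (fun e v => extends (t1 e v) (t2 e v) (t3 e v)).
Proof. by apply: (@dfn_sub3 _ _ _ _ _ _ (fun _ => extends)); rewrite /extends; dfn. Qed.

Lemma dfn_kb t1 t2 : ptfn t1 -> ptfn t2 -> pdef (fun v => kb (t1 v) (t2 v)).
Proof. by apply: (@dfn_sub2 _ _ _ _ _ _ (fun _ => kb)); rewrite /kb /agree_below; dfn. Qed.

Lemma kb_total s t n m : is_seq s n -> is_seq t m -> [\/ kb s t, s = t | kb t s].
Proof.
move=> hs ht; apply: NNPP => hn; have [hsn hs1 _ _] := hs; have [htn ht1 _ _] := ht.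
have hdiff : exists2 k, is_nat k & ~ forall x, opair k x ∈ s <-> opair k x ∈ t.
  apply: NNPP => h; apply: hn; constructor 2; apply: set_ext => p.
  have h' k x : is_nat k -> opair k x ∈ s <-> opair k x ∈ t.
    by move=> hk; apply: NNPP => h'; apply: h; exists k => // h2; apply: h'.
  split=> hp.
    by have [k [x [hk e]]] := hs1 p hp; rewrite e -h' -?e //; exact: nat_mem hsn hk.
  by have [k [x [hk e]]] := ht1 p hp; rewrite e h' -?e //; exact: nat_mem htn hk.
have [|k [hk hd hmin]] := nat_least _ hdiff; first by dfn.
have ag : agree_below k s t by move=> j hj; apply: NNPP => h; exact: hmin hj h.
have ag' : agree_below k t s by move=> j hj x; rewrite (ag j hj).
case: (classic (exists x, opair k x ∈ s)) => hx; case: (classic (exists x, opair k x ∈ t)) => hy.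
- have [[x hx'] [y hy']] := (hx, hy); have [h|h|h] := L_total x y.
  + by apply: hn; constructor 1; exists k; split=> //; right; exists x, y.
  + apply: hd => z; rewrite h in hx'.
    have [_ _ fs _] := hs; have [_ _ ft _] := ht.
    by split=> hz; [rewrite (fs _ _ _ hz hx') | rewrite (ft _ _ _ hz hy')].
  + by apply: hn; constructor 3; exists k; split=> //; right; exists y, x.
- by apply: hn; constructor 1; exists k; split=> //; left.
- by apply: hn; constructor 3; exists k; split=> //; left.
- by apply: hd => z; split=> hz; [case: hx|case: hy]; exists z.
Qed.

(** If [P] has no least element then this branch never ends, and its entries
    contradict the well-foundedness of [R]. *)
Definition leftmost (P : M -> Prop) s n :=
  [/\ is_seq s n, exists2 t, P t & subset s t
    & forall k t x y, k ∈ n -> P t -> agree_below k s t ->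
        opair k x ∈ s -> opair k y ∈ t -> ~ L (opair y x)].

(** The new entry is the [L]-least one found at position [n] in members of [P] extending [s]. If
    there were none, [s] itself would be in [P], and a member preceding it would either branch off
    to its left, which [leftmost] forbids, or extend it. *)
Lemma leftmost_snoc (P : M -> Prop) s n : pdef (fun v => P (v 0)) ->
  (forall t, P t -> node t) -> (forall s, P s -> exists2 t, P t & kb t s) ->
  leftmost P s n -> exists c, leftmost P (snoc s n c) (succ n).
Proof.
move=> hP Pnode nomin [hs [t0 ht0 hst0] hl]; have [hn hs1 hs2 hs3] := hs.
have subE t : agree_below n s t -> subset s t.
  by move=> h p hp; have [k [x [hk e]]] := hs1 p hp; rewrite e -(h k hk) -e.
have [c [t ht [hst hc]] cmin] : exists2 c, (exists2 t, P t & subset s t /\ opair n c ∈ t) &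
    forall y, (exists2 t, P t & subset s t /\ opair n y ∈ t) -> ~ L (opair y c).
  apply: (@L_least (fun c => exists2 t, P t & subset s t /\ opair n c ∈ t)); first by dfn.
  apply: NNPP => hnone.
  have nodef t : P t -> subset s t -> forall m, is_seq t m -> ~ n ∈ m.
    by move=> hPt hst m [_ _ _ h] /h [c hc]; apply: hnone; exists c, t.
  have es : s = t0.
    apply: set_ext => p; split=> [|hp]; first exact: hst0.
    have [m [hm _ _]] := Pnode _ ht0; have [hm1 hm2 hm3 hm4] := hm.
    have [k [x [hk e]]] := hm2 p hp; rewrite e in hp *.
    have hnk := nodef _ ht0 hst0 _ hm.
    have [h|h|h] := nat_total (nat_mem hm1 hk) hn.
    - by have [x' hx'] := hs3 k h; rewrite (hm3 _ _ _ hp (hst0 _ hx')).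
    - by case: hnk; rewrite -h.
    - by case: hnk; exact: nat_trans hm1 hk h.
  rewrite -es in ht0; have [t ht [k [hk ag]]] := nomin s ht0.
  have [m [hm _ _]] := Pnode _ ht; have [hm1 hm2 hm3 hm4] := hm.
  case=> [[[x hx] hnx]|[x [y [hx hy hL]]]]; last first.
    apply: (hl k t y x) hL => //; first exact: seqn_dom hs hy.
    by move=> j hj z; rewrite (ag j hj).
  have hkm := seqn_dom hm hx.
  have hnk : n = k \/ n ∈ k.
    by have [h|h|h] := nat_total hk hn; [case: hnx; exact: hs3 | left | right].
  apply: (nodef t ht _ _ hm); last by case: hnk => [->//|h]; exact: nat_trans hm1 hkm h.
  apply: subE => j hj z; rewrite ag //.
  by case: hnk => [<-//|h]; exact: nat_trans hk h hj.
exists c; split; first exact: seqn_snoc.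
  by exists t => // p; rewrite in_snoc => -[/hst|->].
move=> k u x y; rewrite in_succ => hk hu ag.
have ag' j : j ∈ n -> j ∈ k -> forall z, opair j z ∈ s <-> opair j z ∈ u.
  by move=> hjn hjk z; rewrite -(ag j hjk) in_snoc_lt.
case: hk => [hk|ek].
  rewrite in_snoc_lt // => hx hy; apply: (hl k u x y) => // j hj; apply: ag' => //.
  exact: nat_trans hn hk hj.
rewrite ek (in_snoc_eq _ _ hs) => -> hy; apply: cmin; exists u => //; split=> //.
by apply: subE => j hj; apply: ag'; rewrite ?ek.
Qed.

(** No infinite branch is constructed: the last entries of all leftmost sequences form one class
    [D], in which every entry has an [R]-smaller one. *)
Lemma kb_least (P : M -> Prop) : pdef (fun v => P (v 0)) -> (forall t, P t -> node t) ->
  (exists t, P t) -> exists2 s, P s & forall t, P t -> ~ kb t s.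
Proof.
move=> hP Pnode [t0 ht0]; apply: NNPP => hnone.
have nomin s : P s -> exists2 t, P t & kb t s.
  move=> hs; apply: NNPP => h; apply: hnone; exists s => // t ht hk.
  by apply: h; exists t.
have step s n : leftmost P s n -> _ := fun h => leftmost_snoc hP Pnode nomin h.
have dPt t : ptfn t -> pdef (fun v => P (t v)) by exact: (@dfn_sub1 _ _ _ _ _ _ (fun _ => P) _ hP).
have [D hD] : exists D : cls M, forall c, D c <->
    exists s n, leftmost P s (succ n) /\ opair n c ∈ s.
  by apply: comprehension; rewrite /leftmost /agree_below; dfn; apply: dPt; dfn.
have lm s n : leftmost P s (succ n) -> exists c, opair n c ∈ s.
  by move=> [[_ _ _ h] _ _]; apply: h; exact: mem_succ.
have [||c hc cmin] := R_wf (C := D).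
- move=> c /hD [s [n [[_ [t ht hst] _] hc]]].
  by have [m [_ h _]] := Pnode t ht; exact: h _ _ (hst _ hc).
- have h0 : leftmost P empty empty.
    split; [exact: seqn_empty | by exists t0 => // x /emptyP | by move=> k t x y /emptyP].
  have [c hc] := step _ _ h0; have [d hd] := lm _ _ hc.
  by exists d; rewrite hD; exists (snoc empty empty c), empty.
have [s [n [hs hnc]]] := iffLR (hD c) hc.
have [d hd] := step _ _ hs; apply: (cmin d).
  by rewrite hD; exists (snoc s (succ n) d), (succ n); split=> //; rewrite in_snoc; right.
have [_ [t ht hst] _] := hd; have [m [_ _ h]] := Pnode t ht; rewrite holdsE.
by apply: (h n); apply: hst; rewrite in_snoc; [left|right].
Qed.

Lemma kb_well_order : exists J K : cls M,
  [/\ forall s, J s <-> node s,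
      forall s t, K (opair s t) <-> [/\ node s, node t & kb s t]
    & class_well_order J K].
Proof.
have [J hJ] : exists J : cls M, forall s, J s <-> node s.
  by apply: comprehension; apply: dfn_node; dfn.
have [K hK] : exists K : cls M, forall p, K p <-> exists s t,
    p = opair s t /\ [/\ node s, node t & kb s t].
  by apply: comprehension; dfn; [apply: dfn_node|apply: dfn_node|apply: dfn_kb]; dfn.
have KE s t : K (opair s t) <-> [/\ node s, node t & kb s t].
  by rewrite hK; split=> [[s' [t' [/pair_inj[-> ->]]]]|]; last by exists s, t.
exists J, K; split=> //.
have wf (P : M -> Prop) : pdef (fun v => P (v 0)) -> (forall s, P s -> node s) -> (exists s, P s) ->
    exists2 s, P s & forall t, P t -> ~ K (opair t s).
  move=> h1 h2 h3; have [s hs hmin] := kb_least h1 h2 h3.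
  by exists s => // t ht; rewrite KE => -[_ _]; exact: hmin.
have tot a b : node a -> node b -> [\/ K (opair a b), a = b | K (opair b a)].
  move=> ha hb; have [n [hn _ _]] := ha; have [m [hm _ _]] := hb.
  by have [?|?|?] := kb_total hn hm; [constructor 1; rewrite KE|constructor 2|constructor 3; rewrite KE].
split.
- move=> p; rewrite hK => -[s [t [-> [h1 h2 _]]]]; exists s, t; rewrite !hJ.
  by split=> //; rewrite is_pairE.
- move=> a b c; rewrite !hJ !holdsE => ha hb hc hab hbc; apply: NNPP => hac.
  (* Transitivity comes from the least element of {a, b, c}: if [a] did not precede [c], totality
     would give each of the three a predecessor among them. *)
  have [|||x hx xmin] := wf (fun x => x = a \/ x = b \/ x = c).
  + by dfn.
  + by move=> x [->|[->|->]].
  + by exists a; left.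
  have [//|e|h] := tot a c ha hc.
  + subst c; case: hx xmin => [->|[->|->]] xmin; [case: (xmin b)|case: (xmin a)|case: (xmin b)]; tauto.
  + case: hx xmin => [->|[->|->]] xmin; [case: (xmin c)|case: (xmin a)|case: (xmin b)]; tauto.
- by move=> a b; rewrite !hJ !holdsE; exact: tot.
- move=> C hCJ hC; have [||x hx xmin] := wf _ _ _ hC; first by dfn.
    by move=> s /hCJ/hJ.
  by exists x => // y hy; rewrite holdsE; exact: xmin.
Qed.

Definition single b := snoc empty empty b.

Lemma seqn_single b : is_seq (single b) (succ empty).
Proof. exact/seqn_snoc/seqn_empty. Qed.

Lemma is_last_single b : is_last (single b) b.
Proof. by exists empty; split; [exact: seqn_single | rewrite in_snoc; right]. Qed.

Lemma in_single b k x : opair k x ∈ single b -> k = empty /\ x = b.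
Proof. by rewrite in_snoc => -[/emptyP|/pair_inj]. Qed.

Lemma node_single b : I b -> node (single b).
Proof.
move=> hb; exists empty; split; first exact: seqn_single.
- by move=> k x /in_single[_ ->].
- by move=> k x y _ /in_single[/succ_neq0].
Qed.

Lemma is_last_uniq s x y : is_last s x -> is_last s y -> x = y.
Proof.
move=> [n [hn hx]] [m [hm hy]]; have e := succ_inj (seqn_inj hn hm); rewrite -e in hy.
by have [_ _ f _] := hn; exact: f hx hy.
Qed.

Lemma node_last s : node s -> exists b, I b /\ is_last s b.
Proof.
move=> [n [hn hI _]]; have [_ _ _ h] := hn; have [b hb] := h n (mem_succ n).
by exists b; split; [exact: hI hb | exists n].
Qed.

Lemma extends_last t s d : extends t s d -> is_last t d.
Proof.
move=> [n [hn ->]]; exists (succ n); split; first exact: seqn_snoc.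
by rewrite in_snoc; right.
Qed.

Lemma extends_exists s d : node s -> exists t, extends t s d.
Proof. by move=> [n [hn _ _]]; exists (snoc s (succ n) d), n. Qed.

(** Because of the +∞ convention, the truth values at a child are already available at its
    parent. *)
Lemma extends_kb t s d : extends t s d -> kb t s.
Proof.
move=> [n [hn ->]]; exists (succ n); have [hn1 _ _ _] := hn; split=> //.
  by move=> j hj x; rewrite in_snoc_lt.
left; split; first by exists d; rewrite in_snoc; right.
by case=> y /(seqn_dom hn)/not_mem_self.
Qed.

(** The children of a node depend only on its last entry, so the recursion on the tree copies the
    one along [R]. *)
Lemma extends_node t s d b : node s -> is_last s b -> extends t s d ->
  (node t <-> R (opair d b)).
Proof.
move=> [n [hn hI hR]] [m [hm hb]] [n' [hn' ->]].
have e := succ_inj (seqn_inj hn hm); have e' := succ_inj (seqn_inj hn hn'); subst m n'.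
have [hn1 hn2 hn3 hn4] := hn.
split=> [[k [hk _ h]]|hRdb].
  by apply: (h n); rewrite in_snoc; [left|right].
exists (succ n); split; first exact: seqn_snoc.
- move=> k x; rewrite in_snoc => -[/hI //|/pair_inj[_ ->]].
  by have [a [c [ha _ /is_pairE /pair_inj[-> _]]]] := R_on hRdb.
- move=> k x y; rewrite !in_snoc => -[hx|/pair_inj[ek ex]] [hy|/pair_inj[ek' ey]].
  + exact: hR hx hy.
  + by rewrite ey; rewrite (succ_inj ek') in hx; rewrite (hn3 _ _ _ hx hb).
  + have := seqn_dom hn hy; rewrite ek => h.
    by case: (not_mem_cycle h (mem_succ _)).
  + by have := mem_succ k; rewrite ek' ek => /not_mem_self.
Qed.

End KleeneBrouwer.

Ltac dfn_extra_node := match goal with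
 | |- dfn _ _ (fun _ _ => is_last _ _) => apply: dfn_is_last
 | |- dfn _ _ (fun _ _ => extends _ _ _) => apply: dfn_extends
 end.
Ltac dfn_extra ::= first [dfn_extra_basic | dfn_extra_sets | dfn_extra_seqn
 | dfn_extra_level | dfn_extra_node].

(** * Satisfaction classes and actual satisfaction *)

Section Assignments.
Context {M : gbc}.
Implicit Types (x y z a b c k n p : M).

Lemma is_assignmentE a : is_assignment a <->
  (forall p, p ∈ a -> exists n x, is_nat n /\ p = opair n x) /\
  forall n, is_nat n -> (exists x, opair n x ∈ a) /\
    forall x y, opair n x ∈ a -> opair n y ∈ a -> x = y.
Proof.
split=> -[h1 h2]; split.
- by move=> p /h1 [n [x [hn /is_pairE hp]]]; exists n, x.
- move=> n /h2 [x [/valueE hx hu]]; split; first by exists x.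
  by move=> y z hy hz; rewrite -(hu y) ?valueE // -(hu z) ?valueE.
- by move=> p /h1 [n [x [hn hp]]]; exists n, x; rewrite is_pairE.
- move=> n /h2 [[x hx] hu]; exists x; split; first exact/valueE.
  by move=> y /valueE; exact: hu.
Qed.

Lemma dfn_is_assignment (E CI UI : Type) (ci : CI -> E -> M -> Prop) (ui : UI -> E -> M) t1 :
  tfn ci ui t1 -> dfn ci ui (fun e v => is_assignment (t1 e v)).
Proof.
apply: (@dfn_sub1 _ _ _ _ _ _ (fun _ => @is_assignment M)).
by rewrite /is_assignment /unique; dfn.
Qed.

Lemma assignment_fun a n x y : is_assignment a -> opair n x ∈ a -> opair n y ∈ a -> x = y.
Proof.
move=> /is_assignmentE [h1 h2] hx hy; have [m [z [hm /pair_inj [en _]]]] := h1 _ hx.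
by rewrite -en in hm; have [_ h] := h2 n hm; exact: h.
Qed.

Lemma assignment_total a n : is_assignment a -> is_nat n -> exists x, opair n x ∈ a.
Proof. by move=> /is_assignmentE [_ h] /h []. Qed.

Lemma ex_assignment : exists a : M, is_assignment a.
Proof.
have hE y : y ∈ img (fun n => opair n empty) om <-> exists2 n, is_nat n & y = opair n empty.
  rewrite in_img; last by dfn.
  by split=> -[n hn e]; exists n => //; move: hn; rewrite in_om.
exists (img (fun n => opair n empty) om); rewrite is_assignmentE; split=> [p|n hn].
  by rewrite hE => -[n hn ->]; exists n, empty.
split; first by exists empty; rewrite hE; exists n.
by move=> x y; rewrite !hE => -[m _ /pair_inj[_ ->]] [m' _ /pair_inj[_ ->]].
Qed.

Lemma assignment_update a n x : is_assignment a -> is_nat n ->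
  exists b, [/\ is_assignment b, variant n a b & opair n x ∈ b].
Proof.
move=> ha hn; have [ha1 ha2] := iffLR (is_assignmentE a) ha.
pose b := union2 (sep a (fun p => ~ exists y, p = opair n y)) (upair (opair n x) (opair n x)).
have bE p : p ∈ b <-> (p ∈ a /\ ~ exists y, p = opair n y) \/ p = opair n x.
  by rewrite in_union2 in_upair in_sep; [tauto | dfn].
have ne m y : m <> n -> opair m y ∈ b <-> opair m y ∈ a.
  move=> hmn; rewrite bE; split=> [[[]|/pair_inj[]] //|hy]; left; split=> //.
  by case=> z /pair_inj[].
exists b; split.
- rewrite is_assignmentE; split=> [p|m hm].
    by rewrite bE => -[[/ha1]|->] //; exists n, x.
  case: (classic (m = n)) => [->|hmn]; last first.
    have [[y hy] h] := ha2 m hm; split; first by exists y; rewrite ne.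
    by move=> u w; rewrite !ne //; exact: h.
  split=> [|y z]; first by exists x; rewrite bE; right.
  have e u : opair n u ∈ b -> u = x.
    by rewrite bE => -[[_ []]|/pair_inj[]] //; exists u.
  by move=> /e -> /e ->.
- by move=> m hm hmn y; rewrite !valueE ne.
- by rewrite bE; right.
Qed.

End Assignments.

(** * Codes of standard formulas and their truth *)

Section Coding.
Context {M : gbc}.

(** The variable of de Bruijn index [i] in context [n] is coded by its
    level [n - 1 - i], so that [fEx] in context [n] always binds variable [n]. *)
Definition vcode n (i : 'I_n) : M := num (n - i.+1).

Lemma vcode_nat n (i : 'I_n) : is_nat (vcode i).
Proof. exact: num_nat. Qed.

(** Class variable 0, the restriction in [ETR], receives tag 3 of the predicate [W]; class variable
    1 receives tag 2 of [Z]. *)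
Fixpoint fcode n (phi : form 2 n) : M :=
  match phi with
  | fMem _ i j => ccode2 0 (vcode i) (vcode j)
  | fEq _ i j => ccode2 1 (vcode i) (vcode j)
  | fCls _ i k => ccode (if k == ord0 then 3 else 2) (vcode i)
  | fNeg _ f => ccode 4 (fcode f)
  | fAnd _ f g => ccode2 5 (fcode f) (fcode g)
  | fEx n f => ccode2 6 (num n) (fcode f)
  end.

Lemma fcode_formula n (phi : form 2 n) : is_formula (fcode phi).
Proof.
have [A hA] := @ex_formula_set M.
have [[c0 c1 c2 c3] [c4 c5 c6]] := iffLR (formula_closedE A) (formula_set_closed hA).
rewrite -hA; elim: phi => {n} /=.
- by move=> n i j; apply: c0; exact: num_nat.
- by move=> n i j; apply: c1; exact: num_nat.
- by move=> n i k; case: (k == ord0); [apply: c3|apply: c2]; exact: num_nat.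
- by move=> n f; exact: c4.
- by move=> n f hf g hg; exact: c5.
- by move=> n f hf; apply: c6 => //; exact: num_nat.
Qed.

Lemma vcode0 n : vcode (@ord0 n) = num n.
Proof. by rewrite /vcode subn1. Qed.

Lemma vcode_lift n (i : 'I_n) : vcode (lift ord0 i) = vcode i.
Proof. by rewrite /vcode /= /bump leq0n add1n subSS. Qed.

Lemma vcode_neq n (i : 'I_n) : vcode i <> num n.
Proof.
by move/num_inj/eqP; rewrite ltn_eqF // ltn_subrL (leq_ltn_trans _ (ltn_ord i)).
Qed.

(** Induction in the metatheory on [phi]: on standard formulas a satisfaction class has no
    freedom. *)
Lemma sat_fcode (Z W S : M -> Prop) : satisfaction_class Z W S ->
  forall n (phi : form 2 n) a v, is_assignment a -> (forall i, opair (vcode i) (v i) ∈ a) ->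
  S (opair (fcode phi) a) <-> sat phi (pair2 W Z) v.
Proof.
move=> hS n; elim=> {n} /=.
- move=> n i j a v ha hv; rewrite -holdsE.
  rewrite (sc_mem hS (vcode_nat _) (vcode_nat _) (iffRL (tagged2E _ _ _ _) erefl) ha).
  split=> [[x [y [/valueE hx /valueE hy h]]]|h].
    by rewrite -(assignment_fun ha hx (hv i)) -(assignment_fun ha hy (hv j)).
  by exists (v i), (v j); rewrite !valueE; split.
- move=> n i j a v ha hv; rewrite -holdsE.
  rewrite (sc_eq hS (vcode_nat _) (vcode_nat _) (iffRL (tagged2E _ _ _ _) erefl) ha).
  split=> [[x [y [/valueE hx /valueE hy h]]]|h].
    by rewrite -(assignment_fun ha hx (hv i)) -(assignment_fun ha hy (hv j)).
  by exists (v i), (v j); rewrite !valueE; split.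
- move=> n i k a v ha hv; rewrite -holdsE /pair2; case: (k == ord0).
    rewrite (sc_W hS (vcode_nat _) (iffRL (tagged1E _ _ _) erefl) ha).
    split=> [[x /valueE hx h]|h]; first by rewrite -(assignment_fun ha hx (hv i)).
    by exists (v i); rewrite ?valueE.
  rewrite (sc_Z hS (vcode_nat _) (iffRL (tagged1E _ _ _) erefl) ha).
  split=> [[x /valueE hx h]|h]; first by rewrite -(assignment_fun ha hx (hv i)).
  by exists (v i); rewrite ?valueE.
- move=> n f IH a v ha hv; rewrite -holdsE.
  rewrite (sc_neg hS (fcode_formula f) (iffRL (tagged1E _ _ _) erefl) ha).
  by rewrite holdsE (IH _ v ha hv).
- move=> n f IHf g IHg a v ha hv; rewrite -holdsE.
  rewrite (sc_and hS (fcode_formula f) (fcode_formula g) (iffRL (tagged2E _ _ _ _) erefl) ha).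
  by rewrite !holdsE (IHf _ v ha hv) (IHg _ v ha hv).
move=> n f IH a v ha hv; rewrite -holdsE.
rewrite (sc_ex hS (num_nat _) (fcode_formula f) (iffRL (tagged2E _ _ _ _) erefl) ha).
(* Changing the assignment at [num n] supplies the bound variable and leaves the others intact,
   their codes being smaller numerals. *)
have env b x : variant (num n) a b -> opair (num n) x ∈ b ->
    forall i, opair (vcode i) (scons x v i) ∈ b.
  move=> hab hx i; case: (unliftP ord0 i) => [j|] ->.
    rewrite sconsS vcode_lift -valueE -hab ?valueE //; [exact: num_nat | exact: vcode_neq].
  by rewrite scons0 vcode0.
split=> [[b [hb hab]]|[x hx]].
  have [x hx] := assignment_total hb (num_nat n).
  by rewrite holdsE (IH _ _ hb (env b x hab hx)) => h; exists x.
have [b [hb hab hbx]] := assignment_update x ha (num_nat n).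
by exists b; split=> //; rewrite holdsE (IH _ _ hb (env b x hab hbx)).
Qed.

End Coding.

(** * Definability of satisfaction, and parameter-free formulas *)

Section SatDefinability.
Variables (M : structure) (E CI UI : Type).
Variables (ci : CI -> E -> M -> Prop) (ui : UI -> E -> M).

(** Definable predicates [Q] are substituted for the class variables of [phi]. This turns the
    recursion clause, applied to values read off truth, into a formula again. *)
Lemma dfn_sat m n (phi : form m n) (Q : 'I_m -> E -> (nat -> M) -> M -> Prop)
    (u : 'I_n -> E -> (nat -> M) -> M) :
  (forall k, dfn ci ui (fun e w => Q k e (fun i => w i.+1) (w 0))) ->
  (forall i, tfn ci ui (u i)) ->
  dfn ci ui (fun e v => sat phi (fun k => Q k e v) (fun i => u i e v)).
Proof.
elim: phi Q u => {n} /=.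
- by move=> n i j Q u _ hu; apply: dfn_mem.
- by move=> n i j Q u _ hu; apply: dfn_eq.
- by move=> n i k Q u hQ hu; apply: (dfn_sub (P := fun e x v => Q k e v x)).
- by move=> n f IH Q u hQ hu; apply: dfn_not; exact: IH.
- by move=> n f IHf g IHg Q u hQ hu; apply: dfn_and; [exact: IHf | exact: IHg].
move=> n f IH Q u hQ hu.
apply: (@dfn_ex _ _ _ _ _ _ (fun e v x => sat f (fun k => Q k e v) (scons x (fun i => u i e v)))).
have h1 k : dfn ci ui (fun e w => Q k e (fun i => w i.+2) (w 0)).
  (* The argument of [Q] stays at position 0; the newly bound variable, at position 1, is
     skipped. *)
  exact: (dfn_ren (fun i => if i is j.+1 then j.+2 else 0) (hQ k)).
have h2 i : tfn ci ui (scons (fun _ w => w 0) (fun j e w => u j e (fun l => w l.+1)) i).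
  case: (unliftP ord0 i) => [j|] ->; rewrite ?sconsS ?scons0; last exact: tfn_var.
  exact: (tfn_ren S (hu j)).
apply: dfn_iff (IH (fun k e w x => Q k e (fun l => w l.+1) x) _ h1 h2) => e w.
apply: sat_ext => // i; by case: (unliftP ord0 i) => [j|] ->; rewrite ?sconsS ?scons0.
Qed.

End SatDefinability.

(** With class variables as indices and no set parameters, definability yields one formula for all
    class arguments, which can then be coded or passed to [ETR]. *)
Lemma uniform_formula (M : structure) m n (P : ('I_m -> M -> Prop) -> (nat -> M) -> Prop) :
  dfn (fun (i : 'I_m) X => X i) (fun (u : Empty_set) _ => match u with end) P ->
  exists phi : form m n.+1, forall X v, sat phi X v <-> P X (fun i => v (inord i)).
Proof.
move=> [k [l [cs [ts [phi h]]]]].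
exists (rename phi cs (fun i => if ts i is Var j then inord j else ord0)) => X v.
by rewrite sat_rename -h; apply: sat_ext => // i; case: (ts i) => [j|[]].
Qed.

(** Numerals are definable without parameters, so they may occur where [uniform_formula] is
    applied. *)
Lemma tfn_num (M : gbc) (E CI UI : Type) (ci : CI -> E -> M -> Prop) (ui : UI -> E -> M) k :
  tfn ci ui (fun _ _ => num k).
Proof.
apply: (dfn_iff (P := fun _ v => is_numeral k (v 0))); last by dfn.
by move=> _ v; exact: is_numeralE.
Qed.

(** * From iterated truth to ETR *)

Section TruthToRecursion.
Context {M : gbc}.
Variables (I R Z : cls M) (phi : form 2 2).
Hypothesis R_on : relation_on I R.
Hypothesis R_wf : class_well_founded I R.
Hypothesis truth : iterated_truth M.
Implicit Types (x y a b c d p s : M).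

(** The levels 2, 1, 0 are the [vcode]s of the indices 0, 1, 2. *)
Definition codes_env a x s c :=
  [/\ opair (num 2) x ∈ a, opair (num 1) s ∈ a & opair (num 0) c ∈ a].

(** Stands in for the restriction of the solution: ⟨d, y⟩ belongs to it when [W] declares the
    formula coded by [c] true of [y], the child ending in [d], and [c] itself. *)
Definition child_values (W : M -> Prop) s c p := exists d y s' a,
  [/\ p = opair d y, extends s' s d, codes_env a y s' c & W (opair s' (opair c a))].

Definition node_step (X : 'I_2 -> M -> Prop) x s c := exists2 b, is_last s b &
  sat phi (fun k => if k == ord0 then child_values (X ord0) s c else X k) (pair2 x b).

Definition env3 x s c : 'I_3 -> M := fun i => nth x [:: x; s; c] i.

Lemma ex_step_formula : exists psi : form 2 3, forall X x s c,
  sat psi X (env3 x s c) <-> node_step X x s c.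
Proof.
have [|psi hpsi] := @uniform_formula M 2 2 (fun X v => node_step X (v 0) (v 1) (v 2)).
  apply: (@dfn_ex2 _ _ _ _ _ _ (fun _ v b => is_last (v 1) b)); first by dfn.
  (* The quantified last entry [b] sits at position 0, which moves [x], [s], [c] to 1, 2, 3. *)
  apply: (dfn_iff (P := fun X w => sat phi
    (fun k => if k == ord0 then child_values (X ord0) (w 2) (w 3) else X k)
    (fun i => if i == ord0 then w 1 else w 0))) => [X w|].
    by apply: sat_ext.
  apply: (@dfn_sat _ _ _ _ _ _ _ _ phi
    (fun k X w => if k == ord0 then child_values (X ord0) (w 2) (w 3) else X k)
    (fun i X w => if i == ord0 then w 1 else w 0)) => [k|i].
    case: (k == ord0) => /=; last by dfn.
    by rewrite /child_values /codes_env; dfn; exact: tfn_num.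
  by case: (i == ord0) => /=; dfn.
exists psi => X x s c; rewrite hpsi.
by rewrite /env3 !inordK.
Qed.

Lemma codes_envE a x s c : codes_env a x s c <-> forall i : 'I_3, opair (vcode i) (env3 x s c i) ∈ a.
Proof.
split=> [[h0 h1 h2] [[|[|[|m]]] hi] //|h].
by split; [have := h (@Ordinal 3 0 isT) | have := h (@Ordinal 3 1 isT) | have := h (@Ordinal 3 2 isT)].
Qed.

Lemma ex_codes_env x s c : exists2 a, is_assignment a & codes_env a x s c.
Proof.
have [a ha] := @ex_assignment M.
have [a0 [h0 _ e0]] := assignment_update c ha (num_nat 0).
have [a1 [h1 v1 e1]] := assignment_update s h0 (num_nat 1).
have [a2 [h2 v2 e2]] := assignment_update x h1 (num_nat 2).
exists a2 => //.
have ne j k : j <> k -> num j <> num k :> M by move=> h /num_inj.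
split=> //; rewrite -valueE -(v2 _ (num_nat _)) ?valueE //; try exact: ne.
by rewrite -valueE -(v1 _ (num_nat _)) ?valueE //; exact: ne.
Qed.

Lemma ETR_solution : exists F : cls M,
  (forall p, F p -> exists b x, I b /\ is_pair p b x) /\
  (forall b, I b -> forall x,
     slice F b x <-> sat phi (pair2 (restrict F I R b) (cmem Z)) (pair2 x b)).
Proof.
have [L [L_total L_least]] := global_well_order M.
have [J [K [hJ hK JKwo]]] := kb_well_order R_wf L_total L_least.
have [T hT] := truth Z JKwo.
have [psi hpsi] := ex_step_formula; pose c : M := fcode psi.
pose V s x := exists a, [/\ is_assignment a, codes_env a x s c & T (opair s (opair c a))].
(* [hpsi] holds for every third argument; choosing the code of [psi] itself makes truth at [s]
   depend on truth of the same formula at the children. *)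
have TE s a x : node I R s -> is_assignment a -> codes_env a x s c ->
    T (opair s (opair c a)) <-> node_step (pair2 (restrict T J K s) (cmem Z)) x s c.
  move=> hs ha hc; rewrite -hpsi -(sat_fcode (hT s _) psi ha) ?hJ //.
    by rewrite /slice holdsE.
  exact/codes_envE.
have VE s x a : node I R s -> is_assignment a -> codes_env a x s c ->
    V s x <-> T (opair s (opair c a)).
  move=> hs ha hc; split=> [[b [hb hcb]]|h]; last by exists a.
  by rewrite (TE s b x) // (TE s a x).
have childE s p : node I R s -> child_values (restrict T J K s) s c p <->
    exists d y s', [/\ p = opair d y, extends s' s d, node I R s' & V s' y].
  move=> hs; split=> [[d [y [s' [a [-> he hc [hTp [s'' [q [hJs hKs /is_pairE/pair_inj[e _]]]]]]]]]]|].
    subst s''; have hs' : node I R s' by rewrite -hJ.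
    exists d, y, s'; split=> //; rewrite (VE s' y a) //.
    (* [child_values] does not demand an assignment; [sc_pairs] at the earlier stage shows that [a]
       is one. *)
    have [f [a' [_ ha /is_pairE/pair_inj[_ ->]]]] // := sc_pairs (hT s' hJs) (iffRL (holdsE _ _ _) hTp).
  move=> [d [y [s' [-> he hs' [a [ha hc hTp]]]]]].
  exists d, y, s', a; split=> //; split=> //; exists s', (opair c a).
  rewrite hJ is_pairE holdsE hK; split=> //; split=> //; exact: extends_kb he.
have VS s b x : node I R s -> is_last s b -> V s x <->
    sat phi (pair2 (fun p => exists d y s',
      [/\ p = opair d y, extends s' s d, node I R s' & V s' y]) (cmem Z)) (pair2 x b).
  move=> hs hb; have [a ha hc] := ex_codes_env x s c.
  rewrite (VE s x a) // (TE s a x) //.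
  split=> [[b' hb']|h]; last exists b => //.
    rewrite (is_last_uniq hb' hb); apply: (iffLR (sat_ext _ _ _)) => // k p.
    by rewrite /pair2; case: (k == ord0) => //; exact: childE.
  move: h; apply: (iffLR (sat_ext _ _ _)) => // k p.
  by rewrite /pair2; case: (k == ord0) => //; rewrite childE.
have dV t1 t2 : ptfn t1 -> ptfn t2 -> pdef (fun v => V (t1 v) (t2 v)).
  apply: (@dfn_sub2 _ _ _ _ _ _ (fun _ => V)).
  by rewrite /V /codes_env; dfn; apply: dfn_is_assignment; dfn.
have dN t : ptfn t -> pdef (fun v => node I R (t v)) by exact: dfn_node.
(* [D] collects the entries at which two nodes disagree. At an [R]-minimal one, the children of both
   nodes agree, so the clause gives both nodes the same value. *)
have indep d s t x : node I R s -> node I R t -> is_last s d -> is_last t d -> V s x -> V t x.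
  move=> hs ht hsd htd hV; apply: NNPP => hnV.
  have [D hD] : exists D : cls M, forall d, D d <-> exists s t x,
      [/\ node I R s, node I R t, is_last s d & is_last t d] /\ (V s x /\ ~ V t x).
    by apply: comprehension; dfn; by [apply: dN; dfn | apply: dV; dfn].
  have [||e he emin] := R_wf (C := D).
  - move=> e /hD [s' [t' [x' [[hs' _ hl _] _]]]].
    by have [b [hb hlb]] := node_last hs'; rewrite (is_last_uniq hl hlb).
  - by exists d; rewrite hD; exists s, t, x.
  have [s1 [t1 [x1 [[hs1 ht1 hl1 hl2] [h1 h2]]]]] := iffLR (hD e) he.
  apply: h2; rewrite (VS t1 e x1) //; move: h1; rewrite (VS s1 e x1) //.
  have same u w p : node I R u -> node I R w -> is_last u e -> is_last w e ->
      (exists d y s', [/\ p = opair d y, extends s' u d, node I R s' & V s' y]) ->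
      (exists d y s', [/\ p = opair d y, extends s' w d, node I R s' & V s' y]).
    move=> hu hw hlu hlw [d' [y [s' [-> hex hs' hV']]]].
    have hRd := iffLR (extends_node R_on hu hlu hex) hs'.
    have [t' ht'] := extends_exists d' hw.
    have hnt' := iffRL (extends_node R_on hw hlw ht') hRd.
    exists d', y, t'; split=> //; apply: NNPP => hn.
    apply: (emin d'); last by rewrite holdsE.
    rewrite hD; exists s', t', y; split=> //; split=> //.
      exact: extends_last hex.
    exact: extends_last ht'.
  apply: (iffLR (sat_ext _ _ _)) => // k p; rewrite /pair2; case: (k == ord0) => //.
  by split; exact: same.
have [F hF] : exists F : cls M, forall p, F p <-> exists b x,
    [/\ I b, p = opair b x & V (snoc empty empty b) x].
  by apply: comprehension; dfn; apply: dV; dfn.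
have FE b x : F (opair b x) <-> I b /\ V (single b) x.
  rewrite hF; split=> [[b' [x' [hb /pair_inj[-> ->]]]]|[hb hV]] //.
  by exists b, x.
exists F; split=> [p /hF [b [x [hb -> _]]]|b hb x].
  by exists b, x; rewrite is_pairE.
rewrite /slice holdsE FE.
have hnb := node_single R hb; have hlb := is_last_single b.
rewrite (VS (single b) b x) //.
(* The children of [single b] have two entries; [indep] moves their values to the one-entry
   sequences from which [F] is read. *)
have key p : (exists d y s', [/\ p = opair d y, extends s' (single b) d, node I R s' & V s' y])
    <-> restrict F I R b p.
  rewrite /restrict; split=> [[d [y [s' [-> he hs' hV]]]]|[hp [d [y [hd hRd /is_pairE e]]]]].
    have hRd := iffLR (extends_node R_on hnb hlb he) hs'.
    have hId : I d by have [b' [hb' hlb']] := node_last hs'; rewrite (is_last_uniq (extends_last he) hlb').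
    split; last by exists d, y; rewrite holdsE is_pairE.
    rewrite FE; split=> //; apply: (indep d s') => //; [exact: node_single | exact: extends_last he | exact: is_last_single].
  move: hp; rewrite e FE => -[_ hV]; rewrite holdsE in hRd.
  have [s' he] := extends_exists d hnb.
  have hs' := iffRL (extends_node R_on hnb hlb he) hRd.
  exists d, y, s'; split=> //; apply: (indep d (single d)) => //.
  - exact: node_single.
  - exact: is_last_single.
  - exact: extends_last he.
have -> : restrict F I R b = fun p => exists d y s',
    [/\ p = opair d y, extends s' (single b) d, node I R s' & V s' y].
  by apply: functional_extensionality => p; apply: propositional_extensionality; rewrite key.
by split=> [[]|].
Qed.

End TruthToRecursion.

(** * From ETR to iterated truth *)

Section RecursionToTruth.
Context {M : gbc}.
Variables (Z I R : cls M).
Hypothesis etr : ETR M.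
Hypothesis R_wf : class_well_founded I R.
Implicit Types (x y a b f g h i j k l n p q : M) (X : 'I_2 -> M -> Prop).

(** The Tarski clause for codes [ccode t q] at stage [i]: [X ord0] holds the
    truth values already computed, as pairs [⟨⟨stage, formula⟩, assignment⟩]. *)
Definition tarski_clause (t : nat) X i q a : Prop :=
  match t with
  | 0 => exists k l x y, [/\ q = opair k l, opair k x ∈ a, opair l y ∈ a & x ∈ y]
  | 1 => exists k l x y, [/\ q = opair k l, opair k x ∈ a, opair l y ∈ a & x = y]
  | 2 => exists2 x, opair q x ∈ a & X ord_max x
  | 3 => exists2 x, opair q x ∈ a &
      exists j g b, x = opair j (opair g b) /\ X ord0 (opair (opair j g) b)
  | 4 => ~ X ord0 (opair (opair i q) a)
  | 5 => exists g h, [/\ q = opair g h, X ord0 (opair (opair i g) a)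
           & X ord0 (opair (opair i h) a)]
  | 6 => exists n g b, [/\ q = opair n g, is_assignment b, variant n a b
           & X ord0 (opair (opair i g) b)]
  | _ => False
  end.

(** The tag is an element of the structure, so the case distinction of [tarski_clause] has to become
    a finite disjunction before it can be a formula. *)
Fixpoint some_clause (m : nat) X i (c : M) q a : Prop :=
  if m is m'.+1 then c = num m' /\ tarski_clause m' X i q a \/ some_clause m' X i c q a
  else False.

Definition truth_step X a b := is_assignment a /\
  exists i c q, b = opair i (opair c q) /\ some_clause 7 X i c q a.

Lemma truth_stepE (t : nat) X a i q :
  truth_step X a (opair i (ccode t q)) <-> is_assignment a /\ tarski_clause t X i q a.
Proof.
have h m i' (c : M) q' : some_clause m X i' c q' a <->
    exists2 k : nat, k < m & c = num k /\ tarski_clause k X i' q' a.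
  elim: m => [|m IH] /=; first by split=> [[]|[]].
  rewrite IH; split=> [[hm|[k hk hc]]|[k]]; first by exists m.
    by exists k => //; exact: ltnW.
  by rewrite ltnS leq_eqVlt => /orP[/eqP->|hk] hc; [left|right; exists k].
split=> -[ha hx]; split=> //.
  have [i' [c [q' [/pair_inj[<- /pair_inj[<- <-]]]]]] := hx.
  by rewrite h => -[k _ [/num_inj <-]].
exists i, (num t), q; split=> //; rewrite h; exists t => //.
(* From tag 7 on the clause is [False]. *)
by move: hx; do 7 case: t => [|t] //.
Qed.

Lemma ex_truth_formula : exists phi : form 2 2, forall X a b,
  sat phi X (pair2 a b) <-> truth_step X a b.
Proof.
have [|phi hphi] := @uniform_formula M 2 1 (fun X v => truth_step X (v 0) (v 1)).
  rewrite /truth_step /some_clause /tarski_clause /variant.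
  by dfn; first [exact: tfn_num | apply: dfn_is_assignment; dfn].
by exists phi => X a b; rewrite hphi /pair2 -!val_eqE /= !inordK.
Qed.

Lemma truth_predicate : exists T, iterated_truth_predicate I R Z T.
Proof.
have [A hA] := @ex_formula_set M.
have [[c0 c1 c2 c3] [c4 c5 c6]] := iffLR (formula_closedE A) (formula_set_closed hA).
have [K hK] : exists K : cls M, forall p, K p <-> exists i f, [/\ p = opair i f, I i & f ∈ A].
  by apply: comprehension; dfn.
have KE i f : K (opair i f) <-> I i /\ f ∈ A.
  by rewrite hK; split=> [[i' [f' [/pair_inj[-> ->]]]]|[]] //; exists i, f.
have [Q hQ] : exists Q : cls M, forall p, Q p <-> exists j g i f,
    [/\ p = opair (opair j g) (opair i f), K (opair j g), K (opair i f)
      & R (opair j i) \/ j = i /\ subformula g f].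
  by apply: comprehension; rewrite /subformula /ccode2 /ccode; dfn.
have QE j g i f : Q (opair (opair j g) (opair i f)) <->
    [/\ K (opair j g), K (opair i f) & R (opair j i) \/ j = i /\ subformula g f].
  rewrite hQ; split=> [[j' [g' [i' [f' [/pair_inj[/pair_inj[-> ->] /pair_inj[-> ->]]]]]]]|[]] //.
  by exists j, g, i, f.
have Q_on : relation_on K Q.
  move=> p /hQ [j [g [i [f [-> h1 h2 _]]]]].
  by exists (opair j g), (opair i f); rewrite is_pairE.
(* Lexicographic: first an [R]-minimal stage occurring in [C], then a minimal formula at that
   stage. *)
have Q_wf : class_well_founded K Q.
  move=> C hCK [p hp]; have [i [f [e _ _]]] := iffLR (hK p) (hCK p hp).
  rewrite e in hp; have [D hD] : exists D : cls M, forall i, D i <-> exists f, C (opair i f).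
    by apply: comprehension; dfn.
  have [||i0 /hD [f0 hf0] imin] := R_wf (C := D).
  - by move=> j /hD [g /hCK]; rewrite KE => -[].
  - by exists i; rewrite hD; exists f.
  have [||f1 [_ hf1 fmin]] := @subformula_wf M (fun f => C (opair i0 f)).
  - by dfn.
  - by exists f0; split=> //; move/hCK: hf0; rewrite KE -hA => -[].
  exists (opair i0 f1) => // y hy; have [j [g [ey _ _]]] := iffLR (hK y) (hCK y hy).
  subst y; rewrite holdsE QE => -[_ _ [hR|[ej hs]]].
    by apply: (imin j); [rewrite hD; exists g | rewrite holdsE].
  by subst j; exact: fmin hs hy.
have [phi hphi] := ex_truth_formula.
have [F [hF1 hF2]] := etr Q_on Q_wf phi Z.
have FK i f a : F (opair (opair i f) a) -> I i /\ f ∈ A.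
  by move/hF1 => [b [x [hb /is_pairE/pair_inj[e _]]]]; rewrite -e KE in hb.
pose earlier i f : M -> Prop := restrict F K Q (opair i f).
have FE i (t : nat) q a : I i -> ccode t q ∈ A -> F (opair (opair i (ccode t q)) a) <->
    is_assignment a /\ tarski_clause t (pair2 (earlier i (ccode t q)) (cmem Z)) i q a.
  move=> hi hf; rewrite -truth_stepE -hphi -hF2 ?KE //.
  by rewrite /slice holdsE.
have RE i f j g a : I i -> f ∈ A -> earlier i f (opair (opair j g) a) <->
    F (opair (opair j g) a) /\ (R (opair j i) \/ j = i /\ subformula g f).
  move=> hi hf; rewrite /earlier /restrict; split=> [[h [b [x [_ hb]]]]|[h hr]].
    rewrite is_pairE => /pair_inj[e _]; subst b; move: hb; rewrite holdsE QE => -[_ _] //.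
  have [hj hg] := FK _ _ _ h; split=> //; exists (opair j g), a.
  by rewrite holdsE QE !KE is_pairE.
(* The recursion yields ⟨⟨i, f⟩, a⟩, whereas slices of a truth predicate require ⟨i, ⟨f, a⟩⟩. *)
have [T hT] : exists T : cls M, forall p, T p <-> exists i f a,
    p = opair i (opair f a) /\ F (opair (opair i f) a).
  by apply: comprehension; dfn.
have TE i f a : T (opair i (opair f a)) <-> F (opair (opair i f) a).
  rewrite hT; split=> [[i' [f' [a' [/pair_inj[-> /pair_inj[-> ->]]]]]]|] //.
  by exists i, f, a.
have SE i f a : holds (slice T i) f a <-> F (opair (opair i f) a).
  by rewrite holdsE /slice holdsE TE.
exists T => i hi; split.
- move=> p; rewrite /slice holdsE hT => -[i' [f [a [/pair_inj[<- ->] h]]]].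
  have [_ hf] := FK _ _ _ h; exists f, a; rewrite -hA is_pairE; split=> //.
  have : slice F (opair i f) a by rewrite /slice holdsE.
  by rewrite hF2 ?KE // hphi => -[].
- move=> c k l a hk hl /tagged2E -> ha; rewrite SE FE //; last exact: c0.
  split=> [[_ [k' [l' [x [y [/pair_inj[<- <-] h1 h2 h3]]]]]]|[x [y [h1 h2 h3]]]].
    by exists x, y; rewrite !valueE.
  by split=> //; exists k, l, x, y; rewrite -!valueE.
- move=> c k l a hk hl /tagged2E -> ha; rewrite SE FE //; last exact: c1.
  split=> [[_ [k' [l' [x [y [/pair_inj[<- <-] h1 h2 h3]]]]]]|[x [y [h1 h2 h3]]]].
    by exists x, y; rewrite !valueE.
  by split=> //; exists k, l, x, y; rewrite -!valueE.
- move=> c k a hk /tagged1E -> ha; rewrite SE FE //; last exact: c2.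
  split=> [[_ [x h1 h2]]|[x h1 h2]]; first by exists x; rewrite ?valueE.
  by split=> //; exists x; rewrite -?valueE.
- move=> c k a hk /tagged1E -> ha; rewrite SE FE //; last exact: c3.
  split=> [[_ [x h1 [j [g [b [e h2]]]]]]|[x h1 [h2 [j [y [hj hR /is_pairE e]]]]]].
    exists x; rewrite ?valueE // e /restrict TE.
    move: h2; rewrite /pair2 /= RE //; last exact: c3.
    (* An atomic code has no subformulas, so the values seen by the recursion here all come from
       stages before [i], as the predicate [W] demands. *)
    case=> h [hR|[_ /subformulaE //]]; split=> //.
    exists j, (opair g b); rewrite holdsE is_pairE; split=> //.
    by have [] := FK _ _ _ h.
  split=> //; exists x; rewrite -?valueE //.
  have [j' [g [b [e' hF]]]] := iffLR (hT x) h2.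
  exists j', g, b; split=> //; rewrite /pair2 /= RE //; last exact: c3.
  split=> //; left; move: hR; rewrite holdsE.
  by move: e; rewrite e' => /pair_inj[->].
- move=> c f a /hA hf /tagged1E -> ha; rewrite !SE FE //; last exact: c4.
  rewrite /= /pair2 /= RE //; last exact: c4.
  split=> [[_ h] h'|h]; last by split=> // -[].
  by apply: h; split=> //; right; split=> //; constructor 1.
- move=> c f g a /hA hf /hA hg /tagged2E -> ha; rewrite !SE FE //; last exact: c5.
  rewrite /= /pair2 /=; split=> [[_ [f' [g' [/pair_inj[<- <-]]]]]|[h1 h2]].
    by rewrite !RE //; [move=> [? _] [? _] | exact: c5 | exact: c5].
  split=> //; exists f, g; rewrite !RE //; [|exact: c5 | exact: c5].
  split=> //; split=> //; right; split=> //; [by constructor 2; exists g | by constructor 3; exists f].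
move=> c n f a hn /hA hf /tagged2E -> ha; rewrite !SE FE //; last exact: c6.
rewrite /= /pair2 /=; split=> [[_ [n' [f' [b [/pair_inj[<- <-] hb hv]]]]]|[b [hb hv]]].
  rewrite RE //; last exact: c6.
  by case=> h _; exists b; rewrite SE.
rewrite SE => h; split=> //; exists n, f, b; rewrite RE //; last exact: c6.
by split=> //; split=> //; right; split=> //; constructor 4; exists n.
Qed.

End RecursionToTruth.

Theorem theorem6 (M : structure) (hM : GBC M) : ETR M <-> iterated_truth M.
Proof.
split=> h.
  by move=> Z I R [_ _ _ R_wf]; exact: (@truth_predicate (GBModel hM)).
by move=> I R R_on R_wf phi Z; exact: (@ETR_solution (GBModel hM)).
Qed.
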